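(* There exist a (sufficiently large) constant $C(A,B)>0$ and a strictly positive constant $c=c(A,B)$, depending only on the parameters $A,B$ of the controllable system $$\dot x=Ax+Bu,\quad x\in\mathbb{R}^N,\quad u\in\mathbb{R},\quad |u|\le 1,$$ such that the following holds. Suppose that the system moves from the level set $\rho=M$ to the level set $\rho=N_1$ under the feedback control $u(x)=-\operatorname{sign}\langle B,p(x)\rangle$, $p(x)=\frac{\partial\rho}{\partial x}(x)$, in a time interval of integer length $T$, where $M,N_1\geq C(A,B)$. Then $$T\leq c\,(M-N_1).$$
   Context: Standing setting: $A$ is a real $N\times N$ matrix, diagonalizable (over $\mathbb{C}$) with purely imaginary spectrum, $B\in\mathbb{R}^N$ is a column vector, and the linear system $\dot x=Ax+Bu$ is controllable. $\langle\cdot,\cdot\rangle$ is the standard scalar product in $\mathbb{R}^N$. Reachable set: $\mathcal{D}(T)$ is the reachable set in time $T$ with respect to backward time, starting at the equilibrium $0$; that is, the set of all $x_0\in\mathbb{R}^N$ for which there is a measurable control $u$ with $|u|\le1$ on $[0,T]$ such that the solution of $\dot x=Ax+Bu$, $x(0)=x_0$, satisfies $x(T)=0$. The body $\Omega$: as $T\to\infty$, $\mathcal{D}(T)$ equals asymptotically $T\Omega$, where $\Omega\subset\mathbb{R}^N$ is a fixed convex body; that is, $\Omega$ is the limit of $\frac1T\mathcal{D}(T)$ in the Hausdorff metric. Its support function is $H_\Omega(p)=\sup_{x\in\Omega}\langle p,x\rangle$. The norm $\rho$: for $x\in\mathbb{R}^N$, $x\ne0$, $\rho(x)>0$ is defined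 by $x=\rho(x)\phi$ with $\phi\in\partial\Omega$, and $\rho(0)=0$; thus $\rho$ is the norm with unit ball $\Omega$. The following regularity properties are part of the standing setting: $H_\Omega$ is differentiable away from $0$, the boundary $\partial\Omega$ is smooth, and $\rho$ is twice differentiable away from $0$ with Hessian $\partial^2\rho/\partial x^2$ bounded on the unit sphere $|x|=1$. The vector $p(x)=\frac{\partial\rho}{\partial x}(x)$, $x\neq 0$, is the gradient of $\rho$; equivalently, up to a positive factor it is the $p$ determined by $x=\rho(x)\frac{\partial H_\Omega}{\partial p}(p)$. Motion under the control: a trajectory is an absolutely continuous function $x(t)$ satisfying, for almost every $t$, $\dot x(t)=Ax(t)+Bu(t)$ with $u$ measurable, $|u(t)|\le1$, and $u(t)=-\operatorname{sign}\langle B,p(x(t))\rangle$ whenever $\langle B,p(x(t))\rangle\neq0$. The system moves from the level set $\rho=M$ to the level set $\rho=N_1$ in a time interval of length $T$ if $\rho(x(0))=M$ and $\rho(x(T))=N_1$ for such a trajectory on $[0,T]$. *)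

(* Defs.v *)
From HB Require Import structures.
From mathcomp Require Import all_boot all_order all_algebra.
From mathcomp Require Import complex.
From mathcomp Require Import all_classical all_reals all_analysis.
Set Implicit Arguments.
Unset Strict Implicit.
Unset Printing Implicit Defensive.
Import Order.TTheory GRing.Theory Num.Theory.
Import numFieldNormedType.Exports.
Local Open Scope classical_set_scope.
Local Open Scope ring_scope.

Section Euclidean.
Context {R : realType} {n : nat}.
Implicit Types (x y p : 'cV[R]_n) (S : set 'cV[R]_n).

(* The library norm `|x| on matrices is the sup norm, hence this one. *)
Definition dot x y : R := \sum_i x i 0 * y i 0.
Definition enorm x : R := Num.sqrt (dot x x).

Definition gradient (f : 'cV[R]_n -> R) x : 'cV[R]_n :=
  \col_i 'D_(delta_mx i 0) f x.

Definition hessian (f : 'cV[R]_n -> R) x : 'M[R]_n :=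
  \matrix_(i, j) 'D_(delta_mx j 0) (fun y => gradient f y i 0) x.

Definition boundary S : set 'cV[R]_n := closure S `\` interior S.

Definition thickening S (e : R) : set 'cV[R]_n :=
  [set y | exists2 x, S x & enorm (y - x) <= e].

Definition hausdorff_dist S1 S2 : \bar R :=
  ereal_inf [set e%:E | e in
    [set e : R | [/\ 0 <= e, S1 `<=` thickening S2 e
                  & S2 `<=` thickening S1 e]]].

Definition convex_body S : Prop :=
  [/\ compact S, convex_set (S : set (convex_lmodType 'cV[R]_n))
    & interior S !=set0].

Definition support_fun S p : R := sup [set dot p x | x in S].

Definition outer_normal S x p : Prop := forall y, S y -> dot p y <= dot p x.

(* Smoothness in the sense of convex geometry: exactly one supporting
   hyperplane at each boundary point (existence holds for any convex body).
   For a convex body this amounts to the boundary being a C^1 hypersurface. *)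
Definition smooth_boundary S : Prop :=
  forall x, boundary S x -> forall p q, enorm p = 1 -> enorm q = 1 ->
    outer_normal S x p -> outer_normal S x q -> p = q.

(* The r > 0 such that x = r *: phi for some phi in the boundary of S; it
   exists and is unique when S is a convex body with 0 in its interior. *)
Definition rho S x : R :=
  if x == 0 then 0
  else xget 0 [set r : R | 0 < r /\ exists2 phi, boundary S phi & x = r *: phi].

Definition regular_body S : Prop :=
  [/\ forall p, p != 0 -> differentiable (support_fun S) p,
      smooth_boundary S,
      forall x, x != 0 -> differentiable (rho S) x,
      forall x, x != 0 -> differentiable (gradient (rho S)) x
    & exists K : R, forall x, enorm x = 1 -> `|hessian (rho S) x| <= K].

End Euclidean.

Section ControlSystem.
Context {R : realType} {n : nat}.
Implicit Types (A : 'M[R]_n) (B : 'cV[R]_n) (Omega : set 'cV[R]_n).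
Implicit Types (u : R -> R) (x : R -> 'cV[R]_n) (T : R).

Definition diagonalizable_over_C A : Prop :=
  diagonalizable (map_mx (real_complex R) A).

(* Purely imaginary means lying on the imaginary axis; 0 is not excluded. *)
Definition purely_imaginary_spectrum A : Prop :=
  forall a : R[i], eigenvalue (map_mx (real_complex R) A) a -> complex.Re a = 0.

Definition absolutely_continuous (a b : R) x : Prop :=
  forall e : R, 0 < e -> exists2 d : R, 0 < d &
    forall (m : nat) (s t : 'I_m -> R),
      (forall i, a <= s i /\ s i < t i /\ t i <= b) ->
      (forall i j, i != j -> t i <= s j \/ t j <= s i) ->
      \sum_i (t i - s i) < d ->
      \sum_i `|x (t i) - x (s i)| < e.

(* x is a Caratheodory solution of x' = A x + B u on [0, T].
   [measurable_fun] is Borel measurability; since u matters only up to a null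
   set, allowing Lebesgue measurable u gives the same trajectories. *)
Definition solution A B T u x : Prop :=
  [/\ measurable_fun `[0, T] u, absolutely_continuous 0 T x
    & {ae lebesgue_measure, forall t : R, t \in `[0, T] ->
        is_derive t 1 x (A *m x t + u t *: B)}].

(* No bound on the control is imposed here; if B <> 0, absolute continuity
   of x makes u integrable on [0, T]. *)
Definition controllable A B : Prop :=
  forall x0 x1 : 'cV[R]_n, exists T, 0 < T /\ exists u x,
    [/\ solution A B T u x, x 0 = x0 & x T = x1].

Definition reachable A B T : set 'cV[R]_n :=
  [set x0 | exists u x,
    [/\ solution A B T u x, forall t, t \in `[0, T] -> `|u t| <= 1,
        x 0 = x0 & x T = 0]].

Definition asymptotic_body A B Omega : Prop :=
  convex_body Omega /\
  hausdorff_dist [set T^-1 *: x | x in reachable A B T] Omega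
    @[T --> +oo] --> 0%E.

(* The gradient of rho is not defined at 0, so the feedback law puts no
   condition on u at times where x t = 0. *)
Definition feedback_motion A B Omega T u x : Prop :=
  solution A B T u x /\
  {ae lebesgue_measure, forall t : R, t \in `[0, T] ->
    `|u t| <= 1 /\
    (x t != 0 -> dot B (gradient (rho Omega) (x t)) != 0 ->
     u t = - Num.sg (dot B (gradient (rho Omega) (x t))))}.

Definition moves_between_levels A B Omega T (M N1 : R) : Prop :=
  exists u x, [/\ feedback_motion A B Omega T u x,
    rho Omega (x 0) = M & rho Omega (x T) = N1].

End ControlSystem.

(* Main.v *)
Require Import Defs.
From mathcomp Require Import all_boot all_order all_algebra.
From mathcomp Require Import complex.
From mathcomp Require Import all_classical all_reals all_analysis.
From mathcomp Require Import measurable_realfun ring lra.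
Import Order.TTheory GRing.Theory Num.Theory.
Import numFieldNormedType.Exports.
Set Implicit Arguments.
Unset Strict Implicit.
Unset Printing Implicit Defensive.
Local Open Scope classical_set_scope.
Local Open Scope ring_scope.

(* Let [Phi t] be the flow of [x' = A x]; it is bounded because [A] is
   diagonalizable with imaginary spectrum. Cutting off the beginning of a
   trajectory shows [Phi s Omega `<=` Omega] for [0 <= s], so [rho] does not
   increase along the free flow and [<p(x), A x> <= 0]. Hence, under the
   feedback, [rho (x t)] is absolutely continuous with derivative at most
   [- |<B, p(x)>|] almost everywhere.

   It remains to find a drop bounded below over unit time when [rho] is large.
   Put [v = x(k) / rho (x k)]. Over unit time the control moves the state only
   by [O(1)], so after rescaling the motion is a small perturbation of
   [Phi s v]. Either [rho (Phi 1 v) < rho v], or [rho (Phi s v)] is constant on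
   [0, 1]; in the latter case comparing [rho] with [rho \o Phi s] at their
   contact point [v] gives [p(Phi s v) = Phi(-s)^T p(v)], and controllability
   forces [<B, p(Phi s v)> = <Phi(-s) B, p(v)>] to be nonzero for some [s]. Both
   alternatives are stable under perturbation of [v], hence uniform on the
   compact set [rho v = 1]. The gradient of [rho] is homogeneous of degree 0, so
   the bound transfers back to [x].

   [Omega] is determined by [A] and [B], so the constants may depend on it. *)

(** * Absolutely continuous functions *)

Section LebesgueAe.
Context {R : realType}.
Implicit Types P Q S : R -> Prop.

Let ae_filter := ae_filter_ringOfSetsType
  (lebesgue_measure : {measure set (measurableTypeR R) -> \bar R}).

Lemma ae_imply P Q : (forall t, P t -> Q t) ->
  {ae lebesgue_measure, forall t : R, P t} ->
  {ae lebesgue_measure, forall t : R, Q t}.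
Proof. by move=> PQ; have F := ae_filter; apply: filterS. Qed.

Lemma ae_imply2 P Q S : (forall t, P t -> Q t -> S t) ->
  {ae lebesgue_measure, forall t : R, P t} ->
  {ae lebesgue_measure, forall t : R, Q t} ->
  {ae lebesgue_measure, forall t : R, S t}.
Proof. by move=> PQ; have F := ae_filter; apply: filterS2. Qed.

Lemma measurable_shift (s : R) :
  measurable_fun setT (fun t : measurableTypeR R => (t + s : measurableTypeR R)).
Proof.
apply: continuous_measurable_fun => t.
by apply: cvgD; [exact: cvg_id|exact: cvg_cst].
Qed.

(** Lebesgue measure is determined by its values on half-open intervals, and translation keeps their
    length. *)
Lemma lebesgue_measure_shift (s : R) (A : set (measurableTypeR R)) :
  measurable A ->
  pushforward lebesgue_measure
    (fun t : measurableTypeR R => (t + s : measurableTypeR R)) A =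
  lebesgue_measure A.
Proof.
have ms := measurable_shift s.
move=> mA; apply/esym/lebesgue_measure_unique => //= _ [[a b]] _ <-.
rewrite /pushforward/=.
have -> : (fun t : R => t + s) @^-1` `]a, b] = `]a - s, b - s]%classic.
  by apply/seteqP; split=> t /=; rewrite !in_itv/= ltrBlDr lerBrDr.
by rewrite !lebesgue_measure_itv/= !lte_fin ltrD2r -!EFinB opprB addrA subrK.
Qed.

(** Used when a trajectory is restarted at time [s]: the exceptional set is translated and stays
    null. *)
Lemma ae_shift (s : R) P :
  {ae lebesgue_measure, forall t : R, P t} ->
  {ae lebesgue_measure, forall t : R, P (t + s)}.
Proof.
move=> [N [mN N0 subN]].
exists ((fun t : R => t + s) @^-1` N); split.
- rewrite -[X in measurable X]setTI; exact: measurable_shift.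
- by rewrite -N0; exact: lebesgue_measure_shift.
- by move=> t /= nP; exact: subN.
Qed.

End LebesgueAe.

(** * Monotonicity from almost everywhere slopes *)

Section AbsoluteContinuity.
Context {R : realType}.
Implicit Types (a b c : R).

(** The condition of [absolutely_continuous] with values in any normed space, so that it also covers
    scalar functions of a trajectory. *)
Definition abs_cont {V : normedModType R} a b (f : R -> V) : Prop :=
  forall e : R, 0 < e -> exists2 d : R, 0 < d &
    forall (m : nat) (s t : 'I_m -> R),
      (forall i, a <= s i /\ s i < t i /\ t i <= b) ->
      (forall i j, i != j -> t i <= s j \/ t j <= s i) ->
      \sum_i (t i - s i) < d ->
      \sum_i `|f (t i) - f (s i)| < e.

(** Serves for functions of [t] and [x t] that are Lipschitz in both: intervals of small total
    length make both sums on the right small. *)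
Lemma abs_cont_dominated {V W : normedModType R} a b (x : R -> V) (f : R -> W)
    (K : R) :
  abs_cont a b x ->
  (forall s t, a <= s <= b -> a <= t <= b ->
    `|f t - f s| <= K * (`|t - s| + `|x t - x s|)) ->
  abs_cont a b f.
Proof.
move=> acx fx e e0.
pose L := `|K| + 1.
have L0 : 0 < L by rewrite ltr_wpDl.
have eL : 0 < e / L / 2 by rewrite !divr_gt0.
have [d d0 acd] := acx _ eL.
exists (Num.min d (e / L / 2)); first by rewrite lt_min d0.
move=> m s t st dis; rewrite lt_min => /andP[sd se].
have := acd m s t st dis sd => xd.
have -> : e = L * (e / L / 2 + e / L / 2).
  by rewrite -splitr mulrC divfK // gt_eqF.
apply: (@le_lt_trans _ _
  (L * (\sum_i (t i - s i) + \sum_i `|x (t i) - x (s i)|))).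
  rewrite -big_split/= mulr_sumr; apply: ler_sum => i _.
  have [asi [sti tib]] := st i.
  apply: le_trans (fx _ _ _ _) _.
  - by rewrite asi/=; apply: le_trans tib; exact: ltW.
  - by rewrite tib andbT; apply: le_trans (ltW sti).
  - rewrite (@gtr0_norm _ (t i - s i)) ?subr_gt0//.
    apply: ler_wpM2r; first by rewrite addr_ge0// subr_ge0 ltW.
    by rewrite /L (le_trans (ler_norm K))// lerDl.
by rewrite ltr_pM2l // ltrD.
Qed.

(** Let [z] be the supremum of the points where [P] holds. Some such point [s] lies within [r] to
    the left of [z], and the step at [z] carries [P] from [s] to the smaller of [z + r / 2] and [b].
    This point cannot exceed [z], so it is [b]. *)
Lemma interval_induction a b (P : R -> Prop) :
  a <= b -> P a ->
  (forall z, a <= z <= b -> exists2 r, 0 < r &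
    forall s t, a <= s -> t <= b -> s <= z <= t -> z - r < s -> t < z + r ->
      P s -> P t) ->
  P b.
Proof.
move=> ab Pa step.
pose S := [set t | a <= t <= b /\ P t].
have Sa : S a by rewrite /S/= lexx ab.
have hS : has_sup S.
  by split; [exists a|exists b => t [/andP[]]].
have ubS := sup_upper_bound hS.
have zb : sup S <= b by apply: ge_sup hS.1 _ => t [/andP[]].
have [r r0 st] := step (sup S) (introT andP (conj (ubS _ Sa) zb)).
have [s Ss zs] := sup_adherent r0 hS.
pose t := Num.min (sup S + r / 2) b.
have zt : sup S <= t by rewrite le_min zb andbT lerDl divr_ge0 // ltW.
have Pt : P t.
  apply: (st s t) => //; [by case: Ss => /andP[]| | | |exact: Ss.2].
  - by rewrite ge_min lexx orbT.
  - by rewrite ubS.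
  - by rewrite gt_min ltrD2l; apply/orP; left; lra.
have /ubS : S t.
  by split=> //; rewrite (le_trans (ubS _ Sa) zt) ge_min lexx orbT.
by move: Pt; rewrite /t /Num.min; case: ifP => // _ _; lra.
Qed.

(** Since [s] and [s'] lie on opposite sides of [t], the errors [e * (t - s)] and [e * (s' - t)] of
    the linear approximation add up to [e * (s' - s)]. *)
Lemma derive_straddle (f : R -> R) (t l e : R) : 0 < e -> is_derive t 1 f l ->
  exists2 r, 0 < r & forall s s', s <= t <= s' -> t - r < s -> s' < t + r ->
    f s' - f s <= (l + e) * (s' - s).
Proof.
move=> e0 [df fl].
have : h^-1 *: (f (h *: (1 : R) + t) - f t) @[h --> 0^'] --> l.
  by rewrite -fl; exact: df.
move/cvgrPdist_le => /(_ e e0)[r /= r0 fr].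
have key h : `|h| < r -> `|f (h + t) - f t - l * h| <= e * `|h|.
  move=> hr; have [->|h0] := eqVneq h 0.
    by rewrite add0r subrr mulr0 subr0 !normr0 mulr0.
  have := fr h; rewrite /ball/= sub0r normrN => /(_ hr h0).
  rewrite /GRing.scale/= mulr1 => le.
  have -> : f (h + t) - f t - l * h = - h * (l - h^-1 * (f (h + t) - f t)).
    by field.
  by rewrite normrM normrN mulrC ler_wpM2r.
exists r => // s s' /andP[st ts'] sr s'r.
have h1 : `|s - t| < r by rewrite ltr_distlC; lra.
have h2 : `|s' - t| < r by rewrite ltr_distlC; lra.
have := key _ h1; have := key _ h2; rewrite !subrK.
rewrite (ger0_norm (_ : 0 <= s' - t)) ?subr_ge0//.
rewrite (ler0_norm (_ : s - t <= 0)) ?subr_le0//.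
rewrite !ler_norml => /andP[_ ?] /andP[? _]; lra.
Qed.

(* [good t] below covers [a, t] by finitely many steps: around a point of
   differentiability [f] has slope at most [e1]; around an exceptional point
   the step is put in the list [l], whose total length is at most the measure
   of a small open set [U]. *)
Lemma abs_cont_nonincreasing (f : R -> R) a b :
  a <= b -> abs_cont a b f ->
  {ae lebesgue_measure, forall t : R, a <= t <= b ->
    exists2 l, l <= 0 & is_derive t 1 f l} ->
  f b <= f a.
Proof.
move=> ab acf [E [mE E0 subE]].
apply/ler_addgt0Pr => eta eta0.
(* Slopes up to [e1] cost at most [eta / 2] over [[a, b]]; the summand 1 covers [a = b]. The other
   half of [eta] pays for the exceptional steps. *)
pose e1 := eta / 2 / (b - a + 1).
have ba1 : 0 < b - a + 1 by rewrite ltr_wpDl ?subr_ge0.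
have e10 : 0 < e1 by rewrite !divr_gt0.
have eta2 : 0 < eta / 2 by rewrite divr_gt0.
have [d d0 acd] := acf _ eta2.
have Eoo : (lebesgue_measure E < +oo)%E by rewrite E0.
have [U [oU EU Ud]] := lebesgue_regularity_outer mE Eoo d0.
have mU : measurable (U : set (measurableTypeR R)).
  exact: open_measurable.
(* Outer regularity bounds the measure of [U] without [E]; as [E] is null, the bound passes to
   [U]. *)
have Ud' : (lebesgue_measure U < d%:E)%E.
  have -> : lebesgue_measure U = lebesgue_measure (U `\` E).
    rewrite -[in LHS](setDUK EU) measureU//; last by rewrite setDIK.
      exact: etrans (congr1 (fun z => z + _)%E E0) (add0e _).
    exact: measurableD.
  exact: Ud.
pose good t := exists l : seq (R * R),
  [/\ forall p, p \in l -> a <= p.1 /\ p.1 < p.2 /\ p.2 <= t,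
      pairwise (fun p q => q.2 <= p.1) l,
      ((\sum_(p <- l) (p.2 - p.1))%:E <=
         lebesgue_measure (U `&` `[a, t[%classic))%E
    & f t - f a <= e1 * (t - a) + \sum_(p <- l) `|f p.2 - f p.1|].
have good_b : good b.
  apply: (@interval_induction a b good ab).
    exists [::]; rewrite !big_nil; split=> //.
    by rewrite !subrr mulr0 addr0.
  move=> z zab.
  have [Uz|Uz] := pselect (U z); last first.
    have [l lc fl] : exists2 l, l <= 0 & is_derive z 1 f l.
      apply: contrapT => H; apply/Uz/EU/subE => /= K; exact/H/K.
    have [r r0 fr] := derive_straddle e10 fl.
    exists r => // s t as_ tb /andP[sz zt] zs tz [L [L1 L2 L3 L4]].
    have st' := le_trans sz zt.
    exists L; split=> //.
    - by move=> p /L1 [? [? ps]]; do 2!split=> //; exact: le_trans ps st'.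
    - apply: le_trans L3 _; apply: le_measure; rewrite ?inE.
      + by apply: measurableI => //; exact: measurable_itv.
      + by apply: measurableI => //; exact: measurable_itv.
      + apply: setIS => y /=; rewrite !in_itv/= => /andP[-> ys]/=.
        exact: lt_le_trans ys st'.
    - have := fr s t; rewrite sz zt => /(_ isT zs tz).
      have : (l + e1) * (t - s) <= e1 * (t - s).
        by rewrite ler_wpM2r ?subr_ge0// gerDr.
      move: L4; set S := \sum_(_ <- _) _; clear; lra.
  have [r /= r0 rU] := (nbhs_ballP _ _).1 (open_nbhs_nbhs (conj oU Uz)).
  exists r => // s t as_ tb /andP[sz zt] zs tz [L [L1 L2 L3 L4]].
  have [->|neq] := eqVneq t s; first by exists L.
  have st : s < t by rewrite lt_neqAle eq_sym neq (le_trans sz zt).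
  exists ((s, t) :: L); split=> //.
  - move=> p; rewrite inE => /predU1P[->//|/L1[? [? ?]]].
    by do 2!split=> //; exact: le_trans (ltW st).
  - by rewrite /= L2 andbT; apply/allP => p /L1 [_ [_]].
  - rewrite big_cons/=.
    have mst : measurable (`[s, t[%classic : set (measurableTypeR R)).
      exact: measurable_itv.
    have mas : measurable (U `&` `[a, s[%classic : set (measurableTypeR R)).
      by apply: measurableI => //; exact: measurable_itv.
    apply: (@le_trans _ _
      (lebesgue_measure (`[s, t[%classic `|` (U `&` `[a, s[%classic)))).
      rewrite measureU//; last first.
        rewrite -subset0 => y [/=]; rewrite !in_itv/= => /andP[+ _] [_] /andP[_].
        by move=> /le_lt_trans/[apply]; rewrite ltxx.
      have le1 : ((t - s)%:E <= lebesgue_measure (`[s, t[%classic : set R))%E.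
        by rewrite lebesgue_measure_itv/= lte_fin st.
      by rewrite EFinD; exact: leeD le1 L3.
    apply: le_measure; rewrite ?inE.
    + exact: measurableU.
    + by apply: measurableI => //; exact: measurable_itv.
    + move=> y [|[Uy]] /=; rewrite !in_itv/= => /andP[sy ys]; split => //.
      * apply: rU; rewrite /ball/= ltr_distlC (lt_le_trans zs sy).
        exact: lt_trans ys tz.
      * by rewrite (le_trans as_ sy).
      * by rewrite sy (lt_trans ys st).
  - rewrite big_cons/=.
    have := ler_norm (f t - f s).
    have : e1 * (s - a) <= e1 * (t - a).
      by rewrite ler_pM2l// lerD2r ltW.
    move: L4; set S := \sum_(_ <- _) _; clear; lra.
have [l [l1 l2 l3 l4]] := good_b.
(* The list becomes a family indexed by ordinals, the form in which absolute continuity is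
   stated. *)
pose p i := nth (0, 0) l i.
have lp (i : 'I_(size l)) : p i \in l by exact: mem_nth.
have := acd (size l) (fun i => (p i).1) (fun i => (p i).2) (fun i => l1 _ (lp i)).
have ltp (i j : 'I_(size l)) : (i < j)%N -> (p j).2 <= (p i).1.
  by move=> ij; apply: (pairwiseP (0, 0) l2) => //; rewrite inE.
have -> : \sum_(i < size l) `|f (p i).2 - f (p i).1| =
    \sum_(q <- l) `|f q.2 - f q.1|.
  by rewrite [RHS](big_nth (0, 0)) big_mkord.
have -> : \sum_(i < size l) ((p i).2 - (p i).1) = \sum_(q <- l) (q.2 - q.1).
  by rewrite [RHS](big_nth (0, 0)) big_mkord.
have e1b : e1 * (b - a) <= eta / 2.
  by rewrite /e1 mulrAC ler_pdivrMr// ler_wpM2l ?(ltW eta2)// lerDl.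
have ld : \sum_(q <- l) (q.2 - q.1) < d.
  rewrite -lte_fin; apply: le_lt_trans l3 _; apply: le_lt_trans _ Ud'.
  by apply: le_measure; rewrite ?inE//; exact: measurableI.
move=> fd; suff : \sum_(q <- l) `|f q.2 - f q.1| < eta / 2.
  by move: l4 e1b; clear; lra.
apply: fd => // i j ij.
have [/ltp|/ltp|/val_inj ij'] := ltngtP i j; [by right|by left|].
by rewrite ij' eqxx in ij.
Qed.

(** Subtracting [c * t] reduces this to slope at most 0. *)
Lemma abs_cont_slope_le (f : R -> R) a b c :
  a <= b -> abs_cont a b f ->
  {ae lebesgue_measure, forall t : R, a <= t <= b ->
    exists2 l, l <= c & is_derive t 1 f l} ->
  f b - f a <= c * (b - a).
Proof.
move=> ab acf fc; pose g t := f t - c * t.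
suff : g b <= g a by rewrite /g; lra.
apply: abs_cont_nonincreasing => //.
  apply: (@abs_cont_dominated _ _ _ _ f g (1 + `|c|)) => // s t _ _.
  have -> : g t - g s = (f t - f s) - c * (t - s) by rewrite /g; ring.
  apply: le_trans (ler_normB _ _) _; rewrite normrM.
  rewrite mulrDl mul1r mulrDr; have := normr_ge0 (t - s).
  have : 0 <= `|c| * `|f t - f s| by rewrite mulr_ge0. lra.
apply: ae_imply fc => t + tab => /(_ tab)[l lc fl].
exists (l - c *: 1); first by rewrite /GRing.scale/=; lra.
exact: is_deriveB.
Qed.

End AbsoluteContinuity.

(** * The flow of the free system *)

Section MatrixCalculus.
Context {R : realType}.

Lemma mx_entry_le {m n : nat} (A : 'M[R]_(m, n)) i j : `|A i j| <= `|A|.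
Proof.
by rewrite [leRHS]/Num.Def.normr/= mx_normrE; exact: (le_bigmax _ _ (i, j)).
Qed.

Lemma mx_norm_leP {m n : nat} (A : 'M[R]_(m, n)) (c : R) : 0 <= c ->
  (forall i j, `|A i j| <= c) -> `|A| <= c.
Proof.
move=> c0 Ac; rewrite [leLHS]/Num.Def.normr/= mx_normrE.
by apply: bigmax_le => // -[i j] _; exact: Ac.
Qed.

Lemma mulmx_norm_le {m n p : nat} (M : 'M[R]_(m, n)) (N : 'M[R]_(n, p)) :
  `|M *m N| <= n%:R * `|M| * `|N|.
Proof.
apply: mx_norm_leP => [|i j]; first by rewrite !mulr_ge0.
rewrite mxE; apply: le_trans (ler_norm_sum _ _ _) _.
apply: (@le_trans _ _ (\sum_(k < n) `|M| * `|N|)).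
  by apply: ler_sum => k _; rewrite normrM ler_pM ?mx_entry_le.
by rewrite sumr_const card_ord -mulrA mulr_natl.
Qed.

Lemma is_derive_mxP {V : normedModType R} {m n : nat} (M : V -> 'M[R]_(m, n))
    t v D :
  is_derive t v M D <-> forall i j, is_derive t v (fun x => M x i j) (D i j).
Proof.
split=> [[dM eM] i j|dM].
  split; first by move/derivable_mxP : dM.
  by rewrite -eM derive_mx // mxE.
have dM' : derivable M t v by apply/derivable_mxP => i j; case: (dM i j).
split => //; rewrite derive_mx //; apply/matrixP => i j.
by rewrite mxE; case: (dM i j).
Qed.

Lemma is_derive_mulmx {m n p : nat} (M : R -> 'M[R]_(m, n))
    (N : R -> 'M[R]_(n, p)) (t : R) M' N' :
  is_derive t 1 M M' -> is_derive t 1 N N' ->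
  is_derive t 1 (fun s => M s *m N s) (M' *m N t + M t *m N').
Proof.
move=> /is_derive_mxP dM /is_derive_mxP dN; apply/is_derive_mxP => i j.
have -> : (fun x => (M x *m N x) i j) =
    \sum_k ((fun x => M x i k) * (fun x => N x k j)).
  by apply/funext => x; rewrite mxE fct_sumE.
rewrite !mxE -big_split/=.
have -> : \sum_k (M' i k * N t k j + M t i k * N' k j) =
    \sum_k (M t i k *: N' k j + N t k j *: M' i k).
  by apply: eq_bigr => k _; rewrite addrC [M' _ _ * _]mulrC.
by apply: is_derive_sum => k; exact: is_deriveM.
Qed.

Lemma increment_le (f df : R -> R) (K x y : R) :
  (forall z : R, is_derive z 1 f (df z)) ->
  (forall z, Num.min x y <= z <= Num.max x y -> `|df z| <= K) ->
  `|f y - f x| <= K * `|y - x|.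
Proof.
move=> fdf; wlog xy : x y / x <= y => [H|].
  by case/orP: (le_total x y) => xy; [exact: H|
    rewrite distrC (distrC y) minC maxC; exact: H].
rewrite (min_idPl xy) (max_idPr xy) => dfK.
have cf : {within `[x, y], continuous f}.
  apply: continuous_subspaceT => z; apply: differentiable_continuous.
  by apply/derivable1_diffP; case: (fdf z).
have [c cxy ->] := MVT_segment xy (fun z _ => fdf z) cf.
by rewrite normrM ler_wpM2r // dfK // -in_itv.
Qed.

(** Identity theorem for functions with geometrically bounded derivatives. Within distance [r] of a
    common zero, the mean value theorem bounds [psi k] by [r] times a bound on [psi k.+1]. Iterating
    gains a factor 1/2 each time, so all [psi k] vanish there, and steps of length at most [r] reach
    every [t]. *)
Lemma eq0_of_derivatives_eq0 (psi : nat -> R -> R) (C a t0 : R) :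
  (forall k (t : R), is_derive t 1 (psi k) (psi k.+1 t)) ->
  (forall k t, `|psi k t| <= C * a ^+ k) ->
  (forall k, psi k t0 = 0) -> forall k t, psi k t = 0.
Proof.
move=> dpsi psiC psi0.
(* Chosen so that [|a| * r <= 1/2], and positive also for [a = 0]. *)
pose r := (2 * (`|a| + 1))^-1.
have r0 : 0 < r by rewrite invr_gt0 mulr_gt0 // ltr_wpDl.
have psiC' k t : `|psi k t| <= `|C| * `|a| ^+ k.
  by apply: le_trans (psiC k t) _; rewrite -normrX -normrM ler_norm.
have ar : `|a| * r <= 2^-1.
  rewrite /r invfM mulrCA ler_piMr// ler_pdivrMr ?ltr_wpDl// mul1r.
  by rewrite lerDl.
have loc t1 : (forall k, psi k t1 = 0) ->
    forall k t, `|t - t1| <= r -> psi k t = 0.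
  move=> psi1 k t tr.
  have small n : forall k t, `|t - t1| <= r ->
      `|psi k t| <= `|C| * `|a| ^+ k * (2^-1) ^+ n.
    elim: n => [|n IH] {tr}k {}t tr; first by rewrite mulr1.
    have -> : psi k t = psi k t - psi k t1 by rewrite psi1 subr0.
    apply: (@le_trans _ _ ((`|C| * `|a| ^+ k.+1 * (2^-1) ^+ n) * `|t - t1|)).
      apply: increment_le (dpsi k) _ => z zt; apply: IH.
      apply: le_trans tr; move: zt; rewrite /Num.min /Num.max.
      case: ltP => tt1 /andP[z1 z2].
        by rewrite !ger0_norm ?subr_ge0 ?lerD2r//; apply: ltW.
      by rewrite !ler0_norm ?subr_le0// lerN2 lerD2r.
    apply: (@le_trans _ _ ((`|C| * `|a| ^+ k.+1 * (2^-1) ^+ n) * r)).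
      by rewrite ler_wpM2l// !mulr_ge0 ?exprn_ge0// invr_ge0.
    have -> : `|C| * `|a| ^+ k.+1 * (2^-1) ^+ n * r =
        `|C| * `|a| ^+ k * (2^-1) ^+ n * (`|a| * r) by rewrite exprS; ring.
    rewrite [in leRHS]exprSr [leRHS]mulrA ler_wpM2l//.
  apply/normr0_eq0/le_anti; rewrite normr_ge0 andbT.
  have cvg0 : (`|C| * `|a| ^+ k * (2^-1) ^+ n) @[n --> \oo] --> (0 : R).
    rewrite -[X in _ --> X](mulr0 (`|C| * `|a| ^+ k)).
    apply: cvgMr; apply: cvg_expr.
    by rewrite ger0_norm ?invr_ge0// invf_lt1 // ltr1n.
  apply: (@cvgr_to_ge _ _ _ _ _ _ _ cvg0); near=> n; exact: small.
move=> k t.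
have [n nr] : exists n : nat, `|t - t0| <= n.+1%:R * r.
  exists (Num.truncn (`|t - t0| / r)); rewrite -ler_pdivrMr//.
  by apply: ltW; rewrite truncnS_gt// divr_ge0 // ltW.
pose h := (t - t0) / n.+1%:R.
have hr : `|h| <= r.
  by rewrite normrM normfV (@ger0_norm _ n.+1%:R)// ler_pdivrMr// mulrC.
have key m : forall j, psi j (t0 + m%:R * h) = 0.
  elim: m => [|m IH] j; first by rewrite mul0r addr0.
  apply: (loc _ IH); rewrite -natr1 [X in `|X|](_ : _ = h) //; ring.
have := key n.+1 k; rewrite /h mulrCA mulfV ?pnatr_eq0// mulr1.
by rewrite addrC subrK.
Unshelve. all: by end_near. Qed.

End MatrixCalculus.

(** * Real and imaginary parts of complex sums *)

Section ComplexParts.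
Context {R : realType}.
Implicit Types (x : R) (z w : R[i]).

Let Re_add : {morph @complex.Re R : z w / z + w}. Proof. by case=> a b [c d]. Qed.
Let Im_add : {morph @complex.Im R : z w / z + w}. Proof. by case=> a b [c d]. Qed.

Lemma Re_sum (I : Type) (r : seq I) (P : pred I) (F : I -> R[i]) :
  complex.Re (\sum_(i <- r | P i) F i) = \sum_(i <- r | P i) complex.Re (F i).
Proof. exact: (big_morph _ Re_add). Qed.

Lemma Im_sum (I : Type) (r : seq I) (P : pred I) (F : I -> R[i]) :
  complex.Im (\sum_(i <- r | P i) F i) = \sum_(i <- r | P i) complex.Im (F i).
Proof. exact: (big_morph _ Im_add). Qed.

Lemma Re_realM x z : complex.Re (real_complex R x * z) = x * complex.Re z.
Proof. by case: z => a b /=; rewrite mul0r subr0. Qed.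

Lemma Im_realM x z : complex.Im (real_complex R x * z) = x * complex.Im z.
Proof. by case: z => a b /=; rewrite mul0r addr0. Qed.

End ComplexParts.

(** * Spectral form of the bounded flow *)

Section Flow.
Context {R : realType} {n : nat}.
Implicit Types (A : 'M[R]_n).

(** Here [a k] and [b k] are the real and imaginary parts of the spectral projector [E k] for the
    eigenvalue [i * l k]. As [A] is real, taking parts in [A E = i l E], in [E A = A E] and in the
    resolution of the identity gives the real relations. *)
Lemma spectral_projectors A :
  diagonalizable_over_C A -> purely_imaginary_spectrum A ->
  exists (a b : 'I_n -> 'M[R]_n) (l : 'I_n -> R),
  [/\ \sum_k a k = 1%:M, \sum_k b k = 0,
      forall k, A *m a k = - l k *: b k /\ A *m b k = l k *: a k
    & forall k, a k *m A = A *m a k /\ b k *m A = A *m b k].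
Proof.
move=> [P Pu /(diagonalizable_forLR Pu)[D AD]] imA.
pose A' := map_mx (real_complex R) A.
have {}AD : A' = invmx P *m diag_mx D *m P.
  by rewrite /A' AD mxpoly.conjVmx.
(* The rank-one projectors in [P^-1 D P]; an eigenvalue may belong to several [k]. *)
pose E k := col k (invmx P) *m row k P.
have AE k : A' *m E k = D 0 k *: E k.
  rewrite AD /E scalemxAl mulmxA; congr (_ *m _).
  rewrite -(mulmxA _ P) !colE (mulmxA P) mulmxV// mul1mx -mulmxA scalemxAr.
  congr (_ *m _); rewrite mul_diag_mx; apply/matrixP => i j; rewrite !mxE.
  by case: (i =P k) => [->//|_] /=; rewrite !mulr0.
have PA k : row k P *m A' = D 0 k *: row k P.
  rewrite AD !rowE !mulmxA -(mulmxA _ P) mulmxV// mulmx1 scalemxAl.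
  congr (_ *m _); rewrite mul_mx_diag; apply/matrixP => i j; rewrite !mxE.
  by rewrite mulrC; case: (j =P k) => [->//|_] /=; rewrite andbF !mulr0.
have EA k : E k *m A' = A' *m E k by rewrite AE /E -mulmxA PA scalemxAr.
have sumE : \sum_k E k = 1%:M.
  rewrite -(mulVmx Pu); apply/matrixP => i j; rewrite summxE !mxE.
  by apply: eq_bigr => k _; rewrite !mxE big_ord1 !mxE.
(* Row [k] of [P] is a left eigenvector, nonzero because [P] is invertible. *)
have D_im k : complex.Re (D 0 k) = 0.
  apply: imA; apply/eigenvalueP; exists (row k P); first exact: PA.
  apply/eqP => Pk0; have : row k (P *m invmx P) = 0 by rewrite row_mul Pk0 mul0mx.
  rewrite mulmxV// => /matrixP/(_ 0 k).
  by rewrite !mxE eqxx => /eqP; rewrite oner_eq0.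
have DE k z : D 0 k * z =
    Complex (- complex.Im (D 0 k) * complex.Im z) (complex.Im (D 0 k) * complex.Re z).
  move: (D_im k); case: (D 0 k) z => x y [u v] /= ->.
  by apply/eqP; rewrite eq_complex/= !mul0r sub0r add0r mulNr !eqxx.
clearbody E.
exists (fun k => map_mx (@complex.Re R) (E k)),
  (fun k => map_mx (@complex.Im R) (E k)),
  (fun k => complex.Im (D 0 k)).
split.
- apply/matrixP => i j; rewrite summxE.
  under eq_bigr do rewrite mxE.
  rewrite -Re_sum -summxE sumE !mxE; by case: (i == j).
- apply/matrixP => i j; rewrite summxE.
  under eq_bigr do rewrite mxE.
  rewrite -Im_sum -summxE sumE !mxE; by case: (i == j).
- move=> k; split; apply/matrixP => i j; rewrite !mxE.
  + transitivity (complex.Re ((A' *m E k) i j)); last by rewrite AE mxE DE.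
    by rewrite mxE Re_sum; apply: eq_bigr => m _; rewrite !mxE Re_realM.
  + transitivity (complex.Im ((A' *m E k) i j)); last by rewrite AE mxE DE.
    by rewrite mxE Im_sum; apply: eq_bigr => m _; rewrite !mxE Im_realM.
- move=> k; split; apply/matrixP => i j.
  + transitivity (complex.Re ((A' *m E k) i j)).
      rewrite -EA !mxE Re_sum; apply: eq_bigr => m _.
      by rewrite !mxE [in RHS]mulrC Re_realM mulrC.
    by rewrite !mxE Re_sum; apply: eq_bigr => m _; rewrite !mxE Re_realM.
  + transitivity (complex.Im ((A' *m E k) i j)).
      rewrite -EA !mxE Im_sum; apply: eq_bigr => m _.
      by rewrite !mxE [in RHS]mulrC Im_realM mulrC.
    by rewrite !mxE Im_sum; apply: eq_bigr => m _; rewrite !mxE Im_realM.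
Qed.

Lemma dotE (q v : 'cV[R]_n) : dot q v = (q^T *m v) 0 0.
Proof. by rewrite mxE; apply: eq_bigr => i _; rewrite mxE. Qed.

Lemma is_derive_dot (q : 'cV[R]_n) (Z : R -> 'cV[R]_n) (t : R) Z' :
  is_derive t 1 Z Z' -> is_derive t 1 (fun s => dot q (Z s)) (dot q Z').
Proof.
move=> /(is_derive_mulmx (is_derive_cst q^T t (1 : R)))/is_derive_mxP/(_ 0 0).
rewrite mul0mx add0r -dotE.
by have -> : (fun s => dot q (Z s)) = (fun s => (cst q^T s *m Z s) 0 0)
  by apply/funext => s; rewrite dotE.
Qed.

(** The matrix exponential of [t A], described only through the properties used below. *)
Definition bounded_flow A (Phi : R -> 'M[R]_n) : Prop :=
  [/\ Phi 0 = 1%:M, forall t, Phi t *m A = A *m Phi t,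
      forall t : R, is_derive t 1 Phi (A *m Phi t)
    & exists2 K, 0 < K & forall t, `|Phi t| <= K].

(** The witness is the real part of the sum of [exp (i l_k t) E_k]; it is bounded because cosine and
    sine are. *)
Lemma bounded_flow_exists A :
  diagonalizable_over_C A -> purely_imaginary_spectrum A ->
  exists Phi, bounded_flow A Phi.
Proof.
move=> dA iA; have [a [b [l [sa sb Aab abA]]]] := spectral_projectors dA iA.
exists (fun t => \sum_k (cos (l k * t) *: a k - sin (l k * t) *: b k)); split.
- rewrite -sa; apply: eq_bigr => k _.
  by rewrite mulr0 cos0 sin0 scale1r scale0r subr0.
- move=> t; rewrite mulmx_suml mulmx_sumr; apply: eq_bigr => k _.
  have [aA bA] := abA k.
  by rewrite mulmxBl mulmxBr -!scalemxAl -!scalemxAr aA bA.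
- move=> t; apply/is_derive_mxP => i j.
  have -> : (fun s => (\sum_k (cos (l k * s) *: a k - sin (l k * s) *: b k)) i j) =
     \sum_k (fun s => a k i j * cos (l k * s) - b k i j * sin (l k * s)).
    apply/funext => s; rewrite fct_sumE summxE; apply: eq_bigr => k _.
    by rewrite !mxE mulrC [sin _ * _]mulrC.
  rewrite mulmx_sumr summxE; apply: is_derive_sum => k.
  have [Aa Ab] := Aab k.
  rewrite mulmxBr -!scalemxAr Aa Ab !mxE.
  have dl : is_derive t 1 (fun s : R => l k * s) (l k).
    by have := is_deriveZ (l k) (is_derive_id t (1 : R)); rewrite /GRing.scale/= mulr1.
  have dc := is_derive1_comp (is_derive_cos (l k * t)) dl.
  have ds := is_derive1_comp (is_derive_sin (l k * t)) dl.
  have := is_deriveB (is_deriveZ (a k i j) dc) (is_deriveZ (b k i j) ds).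
  by move/is_derive_eq; apply; rewrite /GRing.scale/=; ring.
- exists (1 + \sum_k (`|a k| + `|b k|)).
    by rewrite ltr_wpDr// sumr_ge0// => k _; rewrite addr_ge0.
  move=> t; apply: le_trans (ler_norm_sum _ _ _) _.
  apply: ler_wpDl => //; apply: ler_sum => k _.
  apply: le_trans (ler_normB _ _) _; rewrite !normrZ.
  by rewrite lerD// ler_piMl// ler_norml ?cos_geN1 ?cos_le1 ?sin_geN1 ?sin_le1.
Qed.

Section FlowLaws.
Variables (A : 'M[R]_n) (Phi : R -> 'M[R]_n).
Hypothesis flow : bounded_flow A Phi.

Let flow0 : Phi 0 = 1%:M. Proof. by case: flow. Qed.
Let flow_derive (t : R) : is_derive t 1 Phi (A *m Phi t).
Proof. by case: flow. Qed.

Lemma flow_derive_comp (e c : R) (t : R) :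
  is_derive t 1 (fun s => Phi (e * s + c)) (e *: (A *m Phi (e * t + c))).
Proof.
apply/is_derive_mxP => i j.
have /is_derive_mxP/(_ i j) d1 := flow_derive (e * t + c).
have d2 : is_derive t 1 (fun s : R => e * s + c) e.
  have := is_deriveD (is_deriveZ e (is_derive_id t (1 : R)))
    (is_derive_cst c t (1 : R)).
  by rewrite /GRing.scale/= mulr1 addr0.
have := @is_derive1_comp R (fun x => Phi x i j) (fun s => e * s + c) t _ _ d1 d2.
by move/is_derive_eq; apply; rewrite [RHS]mxE mulrC.
Qed.

(** The successive derivatives [A^k Z] vanish at 0 and are bounded by [K (n |A|)^k], so
    [eq0_of_derivatives_eq0] applies to each entry. *)
Lemma linear_ode_unique (Z : R -> 'M[R]_n) K :
  (forall t : R, is_derive t 1 Z (A *m Z t)) -> (forall t, `|Z t| <= K) ->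
  Z 0 = 0 -> forall t, Z t = 0.
Proof.
move=> dZ ZK Z0 t; apply/matrixP => i j; rewrite [RHS]mxE.
pose Y k s : 'M[R]_n := iter k (mulmx A) (Z s).
have YE k s : Y k s = iter k (mulmx A) 1%:M *m Z s.
  elim: k => [|k IH]; first by rewrite /= mul1mx.
  by rewrite /Y/= -mulmxA -IH.
have dY k (s : R) : is_derive s 1 (Y k) (Y k.+1 s).
  elim: k => [|k IH]; first exact: dZ.
  have := is_derive_mulmx (is_derive_cst A s (1 : R)) IH.
  by rewrite mul0mx add0r.
apply: (@eq0_of_derivatives_eq0 _ (fun k s => Y k s i j) K (n%:R * `|A|) 0
  _ _ _ 0%N t).
- by move=> k s; have /is_derive_mxP := dY k s.
- move=> k s; apply: le_trans (mx_entry_le _ _ _) _.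
  elim: k => [|k IH]; first by rewrite mulr1.
  rewrite /Y/= exprS mulrCA; apply: le_trans (mulmx_norm_le _ _) _.
  by rewrite ler_wpM2l ?mulr_ge0.
- by move=> k; rewrite YE Z0 mulmx0 mxE.
Qed.

(** As functions of [s], both sides solve the same linear equation, are bounded, and agree at
    [s = 0]. *)
Lemma flowD s t : Phi (s + t) = Phi s *m Phi t.
Proof.
have [_ _ _ [K K0 PhiK]] := flow.
apply/eqP; rewrite -subr_eq0; apply/eqP.
apply: (@linear_ode_unique (fun s => Phi (s + t) - Phi s *m Phi t)
  (K + n%:R * K * K)).
- move=> {}s.
  have d1 := flow_derive_comp 1 t s.
  have d2 := is_derive_mulmx (flow_derive s) (is_derive_cst (Phi t) s (1 : R)).
  have := is_deriveB d1 d2; rewrite scale1r !mul1r mulmx0 addr0 -mulmxA -mulmxBr.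
  rewrite /=.
  have -> : (fun s => Phi (s + t) - Phi s *m Phi t) =
    (fun s => Phi (1 * s + t)) - (fun s => Phi s *m cst (Phi t) s).
    apply/funext => r; transitivity (Phi (1 * r + t) - Phi r *m Phi t) => //.
    by rewrite mul1r.
  done.
- move=> r; apply: le_trans (ler_normB _ _) _; rewrite lerD//.
  apply: le_trans (mulmx_norm_le _ _) _.
  by rewrite -!mulrA ler_wpM2l// ler_pM.
- by rewrite add0r flow0 mul1mx subrr.
Qed.

Lemma flowKN t : Phi t *m Phi (- t) = 1%:M.
Proof. by rewrite -flowD addrN. Qed.

Lemma flow_lipschitz : exists2 L, 0 < L &
  forall s t, `|Phi t - Phi s| <= L * `|t - s|.
Proof.
have [_ _ _ [K K0 PhiK]] := flow.
exists (1 + n%:R * `|A| * K).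
  by rewrite ltr_wpDr// !mulr_ge0// ltW.
move=> s t; apply: mx_norm_leP => [|i j].
  by rewrite mulr_ge0// addr_ge0// !mulr_ge0// ltW.
rewrite !mxE.
apply: (@increment_le _ (fun r => Phi r i j) (fun r => (A *m Phi r) i j)).
  by move=> r; have /is_derive_mxP := flow_derive r.
move=> r _; apply: le_trans (mx_entry_le _ _ _) _.
apply: le_trans (mulmx_norm_le _ _) _; apply: ler_wpDl => //.
by rewrite ler_wpM2l// mulr_ge0.
Qed.

(** The derivatives of the pairing are the pairings of [q] with [A^k Phi s B]. All vanish at the
    midpoint of the interval, and they grow geometrically in [k]. *)
Lemma flow_analytic (q B : 'cV[R]_n) (t0 t1 : R) : t0 < t1 ->
  (forall t, t0 < t < t1 -> dot q (Phi t *m B) = 0) ->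
  forall t, dot q (Phi t *m B) = 0.
Proof.
move=> t01 vanish.
have [_ _ _ [K K0 PhiK]] := flow.
pose Y k s : 'cV[R]_n := iter k (mulmx A) (Phi s *m B).
pose psi k s := dot q (Y k s).
have dY k (s : R) : is_derive s 1 (Y k) (Y k.+1 s).
  elim: k => [|k IH].
    have := is_derive_mulmx (flow_derive s) (is_derive_cst B s (1 : R)).
    by rewrite mulmx0 addr0 -mulmxA.
  have := is_derive_mulmx (is_derive_cst A s (1 : R)) IH.
  by rewrite mul0mx add0r.
have dpsi k (s : R) : is_derive s 1 (psi k) (psi k.+1 s).
  exact: is_derive_dot.
have psi0 k : forall s, t0 < s < t1 -> psi k s = 0.
  elim: k => [|k IH] s st; first exact: vanish.
  have [_ <-] := dpsi k s.
  rewrite (@near_eq_derive _ _ _ _ (cst 0)) ?derive_cst//.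
  near=> r; apply: IH.
  near: r; apply: open_nbhs_nbhs; split.
    exact: (@interval_open _ (BRight t0) (BLeft t1)).
  exact: st.
pose m := (t0 + t1) / 2.
have mt : t0 < m < t1 by rewrite !midf_lt.
apply: (@eq0_of_derivatives_eq0 _ psi (n%:R * `|q^T| * (n%:R * K * `|B|))
   (n%:R * `|A|) m dpsi _ (fun k => psi0 k _ mt) 0%N).
move=> k s; rewrite /psi dotE; apply: le_trans (mx_entry_le _ _ _) _.
apply: le_trans (mulmx_norm_le _ _) _.
rewrite -(mulrA (n%:R * `|q^T|)) ler_wpM2l ?mulr_ge0//.
elim: k => [|k IH].
  rewrite mulr1; apply: le_trans (mulmx_norm_le _ _) _.
  by rewrite ler_wpM2r// ler_wpM2l.
rewrite /Y/= exprS mulrCA; apply: le_trans (mulmx_norm_le _ _) _.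
by rewrite ler_wpM2l ?mulr_ge0.
Unshelve. all: by end_near. Qed.

End FlowLaws.
End Flow.

(** * Controlled trajectories *)

Section Trajectories.
Context {R : realType} {n : nat}.
Implicit Types (q v : 'cV[R]_n).

Lemma dot_norm_le q v : `|dot q v| <= n%:R * `|q| * `|v|.
Proof.
apply: le_trans (ler_norm_sum _ _ _) _.
apply: (@le_trans _ _ (\sum_(k < n) `|q| * `|v|)).
  by apply: ler_sum => k _; rewrite normrM ler_pM ?mx_entry_le.
by rewrite sumr_const card_ord -mulrA mulr_natl.
Qed.

Lemma dotDr q v w : dot q (v + w) = dot q v + dot q w.
Proof. by rewrite !dotE mulmxDr mxE. Qed.

Lemma dotZr q v (a : R) : dot q (a *: v) = a * dot q v.
Proof. by rewrite !dotE -scalemxAr mxE. Qed.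

Lemma dotNr q v : dot q (- v) = - dot q v.
Proof. by rewrite -scaleN1r dotZr mulN1r. Qed.

Lemma dotC q v : dot q v = dot v q.
Proof. by apply: eq_bigr => i _; rewrite mulrC. Qed.

Lemma dot_delta i v : dot (delta_mx i 0) v = v i 0.
Proof.
rewrite /dot (bigD1 i)//= mxE !eqxx mul1r big1 ?addr0// => j ji.
by rewrite mxE (negPf ji) mul0r.
Qed.

Lemma dot_eq0 v : dot v v <= 0 -> v = 0.
Proof.
move=> v0; have sq i : 0 <= v i 0 * v i 0 by rewrite -expr2 sqr_ge0.
have : dot v v == 0 by rewrite eq_le v0 sumr_ge0.
rewrite psumr_eq0// => /allP v00; apply/matrixP => i j; rewrite mxE (ord1 j).
by have := v00 i (mem_index_enum _); rewrite mulf_eq0 orbb => /eqP.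
Qed.

Lemma abs_cont_unif {V : normedModType R} a b (x : R -> V) e :
  abs_cont a b x -> 0 < e ->
  exists2 d, 0 < d & forall s t, a <= s -> s <= t -> t <= b -> t - s < d ->
    `|x t - x s| < e.
Proof.
move=> acx e0; have [d d0 xd] := acx _ e0; exists d => // s t as_ st tb tsd.
have [->|ts] := eqVneq t s; first by rewrite subrr normr0.
have := xd 1%N (fun _ => s) (fun _ => t); rewrite !big_ord1; apply => //.
  by move=> _; rewrite lt_neqAle eq_sym ts.
by move=> i j; rewrite !ord1 eqxx.
Qed.

Lemma abs_cont_bounded {V : normedModType R} a b (x : R -> V) :
  a <= b -> abs_cont a b x ->
  exists2 M, 0 <= M & forall t, a <= t <= b -> `|x t| <= M.
Proof.
move=> ab acx; have [d d0 xd] := abs_cont_unif acx ltr01.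
have := @interval_induction _ a b
  (fun t => exists2 M, 0 <= M & forall s, a <= s <= t -> `|x s| <= M) ab.
apply.
  by exists `|x a| => // s /le_anti <-.
(* Radius [d / 2] on each side of [z] gives [t - s < d], so [x] varies by less than 1 between [s]
   and [t]. *)
move=> z zab; exists (d / 2); first by rewrite divr_gt0.
move=> s t as_ tb /andP[sz zt] zs tz [M M0 xM].
exists (M + 1); first by rewrite addr_ge0.
move=> r /andP[ar rt]; have [rs|sr] := leP r s.
  by rewrite ler_wpDr// xM// ar.
rewrite -(subrK (x s) (x r)) (le_trans (ler_normD _ _))// addrC lerD//.
  by rewrite xM// as_/=.
apply/ltW/xd => //; [exact: ltW|exact: le_trans tb|].
by rewrite ltrBlDr; lra.
Qed.

Lemma solution_restrict A B T u (x : R -> 'cV[R]_n) a b :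
  solution A B T u x -> 0 <= a -> b <= T ->
  abs_cont a b x /\ {ae lebesgue_measure, forall t : R, a <= t <= b ->
    is_derive t 1 x (A *m x t + u t *: B)}.
Proof.
move=> [_ acx dx] a0 bT; split.
  move=> e e0; have [d d0 xd] := acx e e0; exists d => // m s t st.
  apply: xd => i; have [? [? ?]] := st i.
  by split; [exact: le_trans a0 _|split=> //; exact: le_trans bT].
apply: ae_imply dx => t + /andP[at_ tb]; apply.
by rewrite in_itv/= (le_trans a0 at_) (le_trans tb bT).
Qed.

Variables (A : 'M[R]_n) (Phi : R -> 'M[R]_n).
Hypothesis flow : bounded_flow A Phi.

(* Constant along trajectories of the uncontrolled system. *)
Definition pairing q c (x : R -> 'cV[R]_n) t := dot q (Phi (c - t) *m x t).

Lemma abs_cont_pairing q c a b (x : R -> 'cV[R]_n) : a <= b ->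
  abs_cont a b x -> abs_cont a b (pairing q c x).
Proof.
move=> ab acx; have [M M0 xM] := abs_cont_bounded ab acx.
have [_ _ _ [K K0 PhiK]] := flow; have [L L0 PhiL] := flow_lipschitz flow.
apply: (@abs_cont_dominated _ _ _ _ _ x _
  (n%:R * `|q| * (n%:R * (L * M) + n%:R * K)) acx).
move=> s t sab tab.
have -> : pairing q c x t - pairing q c x s =
    dot q ((Phi (c - t) - Phi (c - s)) *m x s + Phi (c - t) *m (x t - x s)).
  rewrite /pairing -dotNr -dotDr mulmxBl mulmxBr; congr dot.
  by rewrite [RHS]addrC addrA subrK.
apply: le_trans (dot_norm_le _ _) _.
rewrite -(mulrA (n%:R * `|q|)) ler_wpM2l ?mulr_ge0//.
apply: le_trans (ler_normD _ _) _.
have Ld : `|Phi (c - t) - Phi (c - s)| <= L * `|t - s|.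
  have -> : `|t - s| = `|(c - t) - (c - s)| by rewrite distrC; congr `|_|; ring.
  exact: PhiL.
have h1 : `|(Phi (c - t) - Phi (c - s)) *m x s| <= n%:R * (L * M) * `|t - s|.
  apply: le_trans (mulmx_norm_le _ _) _.
  have -> : n%:R * (L * M) * `|t - s| = n%:R * ((L * `|t - s|) * M) by ring.
  by rewrite -mulrA ler_wpM2l// ler_pM// xM.
have h2 : `|Phi (c - t) *m (x t - x s)| <= n%:R * K * `|x t - x s|.
  apply: le_trans (mulmx_norm_le _ _) _.
  by rewrite ler_wpM2r// ler_wpM2l.
apply: le_trans (lerD h1 h2) _; rewrite mulrDl !mulrDr.
rewrite -addrA lerD2l; apply: ler_wpDl; first by rewrite !mulr_ge0// ltW.
by rewrite ler_wpDl// !mulr_ge0// ltW.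
Qed.

(** Since [A] commutes with the flow, the derivative of [Phi (c - t)] cancels the drift [A x] and
    only the control term is left. *)
Lemma is_derive_pairing q c (x : R -> 'cV[R]_n) (B : 'cV[R]_n) (t ut : R) :
  is_derive t 1 x (A *m x t + ut *: B) ->
  is_derive t 1 (pairing q c x) (ut * dot q (Phi (c - t) *m B)).
Proof.
have [_ comm _ _] := flow; move=> dx.
have dPhi := flow_derive_comp flow (-1) c t.
have := is_derive_dot q (is_derive_mulmx dPhi dx).
have -> : (fun s => dot q (Phi (-1 * s + c) *m x s)) = pairing q c x.
  by apply/funext => s; rewrite /pairing mulN1r addrC.
move/is_derive_eq; apply.
rewrite mulN1r addrC [- t + c]addrC scaleN1r mulNmx mulmxDr !mulmxA comm.
by rewrite addrAC subrr add0r -scalemxAr dotZr.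
Qed.

Lemma pairing_increment q c B T u x a b k :
  solution A B T u x -> 0 <= a -> a <= b -> b <= T ->
  {ae lebesgue_measure, forall t : R, a <= t <= b ->
    u t * dot q (Phi (c - t) *m B) <= k} ->
  pairing q c x b - pairing q c x a <= k * (b - a).
Proof.
move=> sol a0 ab bT ku; have [acx dx] := solution_restrict sol a0 bT.
apply: abs_cont_slope_le => //; first exact: abs_cont_pairing.
apply: ae_imply2 ku dx => t ut dx tab.
exists (u t * dot q (Phi (c - t) *m B)); first exact: ut.
exact/is_derive_pairing/dx.
Qed.

(** By analyticity [q] annihilates every [Phi t B], so pairing with [q] does not feel the control. A
    control steering [- q] to 0 then forces [dot q q <= 0]. *)
Lemma observable B q : controllable A B ->
  (forall s, 0 < s < 1 -> dot q (Phi (- s) *m B) = 0) -> q = 0.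
Proof.
have [flow0 _ _ _] := flow; move=> ctrl q0.
have {}q0 t : dot q (Phi t *m B) = 0.
  apply: (@flow_analytic _ _ _ _ flow q B (-1) 0) => [|s s01]; first by rewrite ltrN10.
  by rewrite -(opprK s) q0// oppr_gt0 ltrNl andbC.
have [T [T0 [u [x [sol x0 xT]]]]] := ctrl (- q) 0.
apply: dot_eq0.
have := @pairing_increment q 0 B T u x 0 T 0 sol (lexx 0) (ltW T0) (lexx T).
rewrite /pairing xT x0 mulmx0 subr0 flow0 mul1mx mul0r dotNr opprK.
rewrite -(scale0r (0 : 'cV[R]_n)) dotZr mul0r add0r; apply.
by apply: aeW => t _; rewrite q0 mulr0.
Qed.

(** The state at time [b], pulled back to time [a] by the flow, differs from [x a] only by the
    accumulated control, at rate at most [c1]. The bounded flow carries this estimate forward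
    again. *)
Lemma drift_bound B : exists2 c, 0 < c & forall T u x a b,
  solution A B T u x ->
  {ae lebesgue_measure, forall t : R, 0 <= t <= T -> `|u t| <= 1} ->
  0 <= a -> a <= b -> b <= T ->
  `|x b - Phi (b - a) *m x a| <= c * (b - a).
Proof.
have [flow0 _ _ [K K0 PhiK]] := flow.
pose c1 := n%:R * K * `|B|.
have c10 : 0 <= c1 by rewrite !mulr_ge0// ltW.
exists (1 + n%:R * K * c1); first by rewrite ltr_wpDr// !mulr_ge0// ltW.
move=> T u x a b sol u1 a0 ab bT.
have back : `|Phi (a - b) *m x b - x a| <= c1 * (b - a).
  (* Applied to plus and minus each coordinate vector, this bounds every entry from both sides. *)
  have key q : (forall v, `|dot q v| <= `|v|) ->
      pairing q a x b - pairing q a x a <= c1 * (b - a).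
    move=> q1; apply: (pairing_increment sol a0 ab bT).
    apply: ae_imply u1 => t + /andP[at_ tb].
    rewrite (le_trans a0 at_) (le_trans tb bT) => /(_ isT) u1.
    apply: le_trans (ler_norm _) _; rewrite normrM -[leRHS]mul1r ler_pM//.
    apply: le_trans (q1 _) _; apply: le_trans (mulmx_norm_le _ _) _.
    by rewrite ler_wpM2r// ler_wpM2l.
  apply: mx_norm_leP => [|i j]; first by rewrite mulr_ge0// subr_ge0.
  have di v : `|dot (delta_mx i 0) v| <= `|v| by rewrite dot_delta mx_entry_le.
  have dNi v : `|dot (- delta_mx i 0) v| <= `|v|.
    by rewrite dotC dotNr normrN dotC.
  have := key _ di; have := key _ dNi.
  rewrite /pairing subrr flow0 mul1mx !(dotC (- _)) !dotNr !(dotC _ (delta_mx _ _)).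
  rewrite !dot_delta !mxE (ord1 j) ler_norml => h1 h2.
  by rewrite h2 andbT; move: h1; clear; lra.
have -> : x b - Phi (b - a) *m x a = Phi (b - a) *m (Phi (a - b) *m x b - x a).
  by rewrite mulmxBr mulmxA -(opprB b a) (flowKN flow) mul1mx.
apply: le_trans (mulmx_norm_le _ _) _.
apply: (@le_trans _ _ (n%:R * K * (c1 * (b - a)))).
  rewrite ler_pM ?mulr_ge0// ler_wpM2l//.
by rewrite mulrA mulrDl mul1r ler_wpDl// subr_ge0.
Qed.

Lemma is_derive_shift_arg {V : normedModType R} (x : R -> V) (s t : R) D :
  is_derive (t + s) 1 x D -> is_derive t 1 (fun r => x (r + s)) D.
Proof.
move=> [dx <-].
have E : (fun h : R => h^-1 *: (x (h *: (1 : R) + t + s) - x (t + s))) =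
    (fun h : R => h^-1 *: (x (h *: (1 : R) + (t + s)) - x (t + s))).
  by apply/funext => h; rewrite addrA.
by split; rewrite /derivable /derive/= E.
Qed.

(** The point [w] is the state at time [s] of a trajectory from [z]: it still reaches 0 in the
    remaining time [T], and [drift_bound] compares it with the free motion. *)
Lemma reachable_shift B : exists2 c, 0 < c & forall T s z,
  0 <= T -> 0 <= s -> reachable A B (T + s) z ->
  exists2 w, reachable A B T w & `|w - Phi s *m z| <= c * s.
Proof.
have [c c0 drift] := drift_bound B; exists c => // T s z T0 s0.
move=> [u [x [sol u1 x0 xT]]].
exists (x s); last first.
  have := drift (T + s) u x 0 s sol; rewrite subr0 x0; apply => //.
    by apply: aeW => t tTs; exact: u1.
  by rewrite lerDr.
have sT t : t \in `[0, T] -> t + s \in `[0, T + s].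
  by rewrite !in_itv/= => /andP[t0 tT]; rewrite addr_ge0// lerD2r.
exists (fun t => u (t + s)), (fun t => x (t + s)); split => //=.
- have [mu acx dx] := sol; split.
  + apply: (measurable_comp _ _ mu (measurable_funTS (measurable_shift s))).
      exact: measurable_itv.
    by move=> _ [t /= tT <-]; exact: sT.
  + move=> e e0; have [d d0 xd] := acx e e0; exists d => // m a b ab dis sd.
    apply: (xd m (fun i => a i + s) (fun i => b i + s)).
    * by move=> i; have [a0 [ab_ bT]] := ab i; rewrite addr_ge0// ltrD2r lerD2r.
    * by move=> i j /dis; rewrite !lerD2r.
    * by under eq_bigr do rewrite opprD addrACA subrr addr0; exact: sd.
  + apply: ae_imply (ae_shift s dx) => t + tT => /(_ (sT _ tT)).
    exact: is_derive_shift_arg.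
- by move=> t /sT; exact: u1.
- by rewrite add0r.
Qed.

End Trajectories.

(** * The asymptotic body *)

Section AsymptoticBody.
Context {R : realType} {n : nat}.
Implicit Types (x y z : 'cV[R]_n) (S Omega : set 'cV[R]_n).

Lemma norm_le_enorm x : `|x| <= enorm x.
Proof.
apply: mx_norm_leP => [|i j]; first exact: sqrtr_ge0.
rewrite (ord1 j) -sqrtr_sqr ler_sqrt ?sumr_ge0// => [|k _]; last first.
  by rewrite -expr2 sqr_ge0.
rewrite /dot (bigD1 i)//= -expr2 lerDl sumr_ge0// => k _.
by rewrite -expr2 sqr_ge0.
Qed.

Lemma closed_approx S x : closed S ->
  (forall e, 0 < e -> exists2 y, S y & `|x - y| <= e) -> S x.
Proof.
move=> cS xS; rewrite ((closure_id S).1 cS) => U /nbhs_ballP[e /= e0 eU].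
have e20 : 0 < e / 2 by rewrite divr_gt0.
have [y Sy xy] := xS _ e20; exists y; split => //; apply: eU.
rewrite -ball_normE/=; apply: le_lt_trans xy _.
by rewrite ltr_pdivrMr// ltr_pMr// ltr1n.
Qed.

Lemma compact_closed_mx S : compact S -> closed S.
Proof. by apply: compact_closed; exact: norm_hausdorff. Qed.

Variables (A : 'M[R]_n) (B : 'cV[R]_n).

(** Pointwise form of the Hausdorff limit, through which properties of reachable sets pass to
    [Omega]. The converse direction uses that [Omega] is closed. *)
Lemma asymptotic_bodyP Omega : asymptotic_body A B Omega -> forall x,
  Omega x <-> forall e, 0 < e ->
    \forall T \near +oo, exists2 z, reachable A B T z & `|x - T^-1 *: z| <= e.
Proof.
move=> [[cO _ _] limO] x.
(* The distance is an infimum, so being below [e] yields an admissible [e' < e]. *)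
have near_body e : 0 < e -> \forall T \near +oo, exists2 e', e' < e &
    [set T^-1 *: z | z in reachable A B T] `<=` thickening Omega e' /\
    Omega `<=` thickening [set T^-1 *: z | z in reachable A B T] e'.
  move=> e0.
  have e0' : (0 < e%:E :> \bar R)%E by rewrite lte_fin.
  have dist_lt : \forall T \near +oo,
      (hausdorff_dist [set T^-1 *: z | z in reachable A B T] Omega < e%:E)%E.
    exact: limO _ (open_ereal_lt' e0').
  apply: filterS dist_lt => T /= /ereal_inf_lt[_ [e' [_ ? ?] <-]].
  by rewrite lte_fin => ?; exists e'.
split=> [Ox e e0|H].
  apply: filterS (near_body e e0) => T [e' e'e [_ sub]].
  have [_ [z Dz <-] xz] := sub _ Ox.
  exists z => //; apply: le_trans (norm_le_enorm _) _.
  exact: le_trans xz (ltW e'e).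
apply: closed_approx => [|e e0]; first exact: compact_closed_mx.
have e20 : 0 < e / 2 by rewrite divr_gt0.
have := filter_ex (filterI (near_body _ e20) (H _ e20)).
move=> [T [[e' e'e [sub _]] [z Dz xz]]].
have [y Oy zy] := sub _ (ex_intro2 _ _ z Dz erefl).
exists y => //; rewrite -(subrK (T^-1 *: z) x) -addrA.
apply: le_trans (ler_normD _ _) _; rewrite (splitr e) lerD//.
apply: le_trans (norm_le_enorm _) _; apply: le_trans zy _; exact: ltW.
Qed.

Lemma asymptotic_body_unique O1 O2 :
  asymptotic_body A B O1 -> asymptotic_body A B O2 -> O1 = O2.
Proof.
move=> h1 h2; apply/seteqP; split=> x.
  by rewrite (asymptotic_bodyP h1) => H; apply/(asymptotic_bodyP h2).
by rewrite (asymptotic_bodyP h2) => H; apply/(asymptotic_bodyP h1).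
Qed.

Lemma reachable_opp T z : reachable A B T z -> reachable A B T (- z).
Proof.
move=> [u [x [[mu acx dx] u1 x0 xT]]].
exists (\- u), (\- x); split=> /=; last 3 first.
- by move=> t /u1; rewrite normrN.
- by rewrite x0.
- by rewrite xT oppr0.
split.
- exact: measurableT_comp.
- move=> e e0; have [d d0 xd] := acx e e0; exists d => // m s t st dis sd.
  have := xd m s t st dis sd.
  by under eq_bigr do rewrite -normrN opprD; under eq_bigr do rewrite opprK.
- apply: ae_imply dx => t + tT => /(_ tT) dx.
  by rewrite mulmxN scaleNr -opprD; exact: is_deriveN.
Qed.

Lemma body_opp Omega x : asymptotic_body A B Omega -> Omega x -> Omega (- x).
Proof.
move=> hO; rewrite !(asymptotic_bodyP hO) => H e e0.
apply: filterS (H e e0) => T [z Dz xz].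
exists (- z); first exact: reachable_opp.
by rewrite scalerN -opprD normrN.
Qed.

(** Approximate [x] by [z / (T + s)] with [z] reachable in time [T + s], and cut off time [s] to get
    [w] near [Phi s z], reachable in time [T]. Dividing by [T] instead of [T + s] makes a difference
    that vanishes as [T] grows. *)
Lemma body_flow (Phi : R -> 'M[R]_n) Omega x s : bounded_flow A Phi ->
  asymptotic_body A B Omega -> 0 <= s -> Omega x -> Omega (Phi s *m x).
Proof.
move=> flow hO s0; rewrite !(asymptotic_bodyP hO) => H e e0.
have [_ _ _ [K K0 PhiK]] := flow.
have [c c0 shift] := reachable_shift flow B.
pose k := n%:R * K + 1.
have k0 : 0 < k by rewrite ltr_wpDl// mulr_ge0// ltW.
have Phik (v : 'cV[R]_n) : `|Phi s *m v| <= k * `|v|.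
  apply: le_trans (mulmx_norm_le _ _) _; rewrite ler_wpM2r// /k.
  by rewrite ler_wpDr// ler_wpM2l.
pose e1 := e / 2 / k.
have e10 : 0 < e1 by rewrite !divr_gt0.
(* The cut-off and the change of divisor together cost at most [s * D / T]. *)
pose D := k * (`|x| + e1) + c.
have [M [Mr HM]] := H e1 e10.
near=> T.
have T1 : 1 <= T by near: T; exact: nbhs_pinfty_ge.
have T0 : 0 < T by exact: lt_le_trans T1.
have TD : s * D / (e / 2) <= T by near: T; apply: nbhs_pinfty_ge; exact: num_real.
have [z Dz xz] : exists2 z, reachable A B (T + s) z & `|x - (T + s)^-1 *: z| <= e1.
  apply: HM; apply: (@lt_le_trans _ _ T); last by rewrite lerDl.
  by near: T; exact: nbhs_pinfty_gt.
have Ts0 : 0 < T + s by rewrite ltr_wpDr.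
have [w Dw wz] := shift _ _ _ (ltW T0) s0 Dz.
exists w => //.
have -> : Phi s *m x - T^-1 *: w = Phi s *m (x - (T + s)^-1 *: z)
    + - (T^-1 *: (s *: (Phi s *m ((T + s)^-1 *: z)) + (w - Phi s *m z))).
  have -> : Phi s *m z = (T + s) *: (Phi s *m ((T + s)^-1 *: z)).
    by rewrite -scalemxAr scalerA mulfV ?scale1r// gt_eqF.
  rewrite mulmxBr; set v := Phi s *m (_ *: z).
  have -> : s *: v + (w - (T + s) *: v) = w - T *: v.
    by rewrite scalerDl opprD addrCA addrA addrACA subrr addr0.
  by rewrite scalerBr scalerA mulVf ?gt_eqF// scale1r opprB addrA subrK.
apply: le_trans (ler_normD _ _) _; rewrite (splitr e) lerD//.
  apply: le_trans (Phik _) _; rewrite -ler_pdivlMl// mulrC//.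
rewrite normrN normrZ normfV (gtr0_norm T0) ler_pdivrMl// mulrC.
rewrite -ler_pdivrMl ?divr_gt0//; apply: le_trans TD; rewrite mulrC.
rewrite ler_wpM2r ?invr_ge0 ?divr_ge0 ?(ltW e0)//.
apply: le_trans (ler_normD _ _) _; rewrite /D mulrDr lerD//; last by rewrite mulrC.
rewrite normrZ (ger0_norm s0) ler_wpM2l//.
apply: le_trans (Phik _) _; rewrite ler_wpM2l ?(ltW k0)//.
rewrite -(subrK x (_ *: z)) addrC; apply: le_trans (ler_normD _ _) _.
by rewrite lerD// distrC.
Unshelve. all: by end_near. Qed.

End AsymptoticBody.

(** * The norm rho *)

Section Gauge.
Context {R : realType} {n : nat}.
Implicit Types (x y v : 'cV[R]_n).
Variable Omega : set 'cV[R]_n.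
Hypothesis body : convex_body Omega.
Hypothesis Omega_opp : forall x, Omega x -> Omega (- x).

Lemma body_closed : closed Omega.
Proof. by case: body => cO _ _; exact: compact_closed_mx. Qed.

Lemma body_bounded : exists M, forall x, Omega x -> `|x| <= M.
Proof.
case: body => cO _ _.
have [M [Mr HM]] := compact_bounded cO.
by exists (M + 1) => x Ox; apply: (HM (M + 1)) => //; rewrite ltrDl.
Qed.

Lemma body_convex x y t : Omega x -> Omega y -> 0 <= t <= 1 ->
  Omega (t *: x + (1 - t) *: y).
Proof.
case: body => _ cvx _ Ox Oy /andP[t0 t1].
have := cvx x y (Itv01 t0 t1) (mem_set Ox) (mem_set Oy).
by move/set_mem.
Qed.

(** With [a] interior, a small [x] is the midpoint of [a + x] and [- (a - x)], both in [Omega] by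
    symmetry. *)
Lemma body_ball : exists2 r, 0 < r & forall x, `|x| <= r -> Omega x.
Proof.
case: body => _ _ [a /nbhs_ballP[e /= e0 eO]].
exists (e / 2) => [|x xe]; first by rewrite divr_gt0.
have near_a y : `|y| <= e / 2 -> Omega (a + y).
  move=> ye; apply: eO; rewrite -ball_normE/= opprD addrA subrr add0r normrN.
  by apply: le_lt_trans ye _; rewrite ltr_pdivrMr// ltr_pMr// ltr1n.
have h1 := near_a x xe.
have h2 : Omega (- (a - x)) by apply/Omega_opp/near_a; rewrite normrN.
have := body_convex h1 h2 (_ : 0 <= 2^-1 <= 1).
have -> : 2^-1 *: (a + x) + (1 - 2^-1) *: - (a - x) = x.
  have -> : 1 - 2^-1 = 2^-1 :> R by rewrite [X in X - _](splitr 1) mul1r addrK.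
  rewrite -scalerDr opprB [a + x + _]addrC addrA subrK.
  have -> : x + x = 2 *: x by rewrite scaler_nat mulr2n.
  by rewrite scalerA mulVf ?scale1r// pnatr_eq0.
by apply; rewrite invr_ge0 ler0n invf_le1 ?ler1n.
Qed.

Lemma body0 : Omega 0.
Proof. by have [r r0] := body_ball; apply; rewrite normr0 ltW. Qed.

Lemma body_shrink x t : Omega x -> 0 <= t <= 1 -> Omega (t *: x).
Proof. by move=> Ox /(body_convex Ox body0); rewrite scaler0 addr0. Qed.

(** Shows that [xget] in [rho] finds a value. The largest multiple [sup S *: x] in [Omega] is a
    boundary point, since a slightly larger multiple leaves [Omega], and [(sup S)^-1] is the
    required factor. *)
Lemma rhoP x : x != 0 -> 0 < rho Omega x /\
  exists2 phi, boundary Omega phi & x = rho Omega x *: phi.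
Proof.
move=> x0; rewrite /rho (negPf x0).
suff : exists r : R, 0 < r /\ exists2 phi, boundary Omega phi & x = r *: phi.
  by move=> /(xgetPex 0).
have nx0 : 0 < `|x| by rewrite normr_gt0.
have [M OM] := body_bounded; have [r r0 rO] := body_ball.
pose S := [set t : R | 0 <= t /\ Omega (t *: x)].
have Sr : S (r / `|x|).
  split; first by rewrite divr_ge0 ?ltW.
  by apply: rO; rewrite normrZ normrM normfV normr_id divfK ?gt_eqF// gtr0_norm.
have hS : has_sup S.
  split; first by exists (r / `|x|).
  exists (M / `|x|) => t [t0 /OM]; rewrite normrZ ger0_norm//.
  by rewrite ler_pdivlMr.
have ubS := sup_upper_bound hS.
have s0 : 0 < sup S.
  by apply: lt_le_trans (ubS _ Sr); rewrite divr_gt0.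
have Os : Omega (sup S *: x).
  apply: closed_approx => [|e e0]; first exact: body_closed.
  have [t [t0 Ot] st] := sup_adherent (divr_gt0 e0 nx0) hS.
  exists (t *: x) => //; rewrite -scalerBl normrZ ger0_norm.
    by rewrite -ler_pdivlMr// lerBlDr -lerBlDl ltW.
  by rewrite subr_ge0 ubS.
exists (sup S)^-1; split; first by rewrite invr_gt0.
exists (sup S *: x); last by rewrite scalerA mulVf ?scale1r// gt_eqF.
split; first exact: subset_closure.
move=> /nbhs_ballP[e /= e0 eO].
have d0 : 0 < e / 2 / `|x| by rewrite !divr_gt0.
have : S (sup S + e / 2 / `|x|).
  split; first by rewrite addr_ge0 ?ltW.
  apply: eO; rewrite -ball_normE/= scalerDl opprD addrA subrr add0r normrN.
  rewrite normrZ normrM normfV normr_id divfK ?gt_eqF//.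
  by rewrite gtr0_norm ?divr_gt0// ltr_pdivrMr// ltr_pMr// ltr1n.
by move/ubS; rewrite gerDl leNgt d0.
Qed.

Lemma rho0 : rho Omega 0 = 0. Proof. by rewrite /rho eqxx. Qed.

Lemma rho_gt0 x : x != 0 -> 0 < rho Omega x.
Proof. by case/rhoP. Qed.

Lemma rho_ge0 x : 0 <= rho Omega x.
Proof.
by have [->|/rho_gt0/ltW//] := eqVneq x 0; rewrite rho0.
Qed.

(** Identifies [rho] with the Minkowski gauge. If [r^-1 *: x] were in [Omega] with [r < p], then
    [phi] would be [r / p] times it, and convexity with a ball around 0 would put a ball around
    [phi] into [Omega], although [phi] is a boundary point. *)
Lemma rho_le x r : 0 < r -> rho Omega x <= r <-> Omega (r^-1 *: x).
Proof.
move=> r0; have [->|x0] := eqVneq x 0.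
  by rewrite rho0 scaler0 ltW//; split=> // _; exact: body0.
have [p0 [phi [cphi nphi] xE]] := rhoP x0; set p := rho Omega x in p0 xE *.
have Ophi : Omega phi by rewrite ((closure_id Omega).1 body_closed).
split=> [pr|Or].
  rewrite xE scalerA; apply: body_shrink => //.
  by rewrite mulr_ge0 ?invr_ge0 ?(ltW r0) ?(ltW p0)//= mulrC ler_pdivrMr// mul1r.
rewrite leNgt; apply/negP => rp; apply: nphi.
have [e e0 eO] := body_ball.
pose s := r / p.
have s1 : 0 < 1 - s by rewrite subr_gt0 ltr_pdivrMr// mul1r.
apply/nbhs_ballP; exists ((1 - s) * e) => /=; first by rewrite mulr_gt0.
move=> y; rewrite -ball_normE/= => yphi.
have -> : y = s *: (r^-1 *: x) + (1 - s) *: ((1 - s)^-1 *: (y - phi)).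
  rewrite !scalerA mulfV ?gt_eqF// scale1r xE scalerA.
  have -> : s / r * p = 1 by rewrite /s; field; rewrite !gt_eqF.
  by rewrite scale1r addrC subrK.
apply: body_convex => //.
  apply: eO; rewrite normrZ normfV (gtr0_norm s1) ler_pdivrMl// distrC.
  exact: ltW.
by rewrite divr_ge0 ?(ltW r0) ?(ltW p0)//= ltW// -subr_gt0.
Qed.

Lemma rho_leP x a : 0 <= a ->
  (forall r, a < r -> Omega (r^-1 *: x)) -> rho Omega x <= a.
Proof.
move=> a0 H; apply/ler_addgt0Pr => e e0.
by apply/rho_le; [exact: ltr_wpDl|apply: H; rewrite ltrDl].
Qed.

Lemma rho_ltW x r : rho Omega x < r -> Omega (r^-1 *: x).
Proof. by move=> xr; apply/rho_le; [exact: le_lt_trans (rho_ge0 x) xr|exact: ltW]. Qed.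

Lemma rhoZ a x : 0 < a -> rho Omega (a *: x) = a * rho Omega x.
Proof.
move=> a0; have le b y : 0 < b -> rho Omega (b *: y) <= b * rho Omega y.
  move=> b0; apply: rho_leP => [|r br]; first by rewrite mulr_ge0 ?rho_ge0 ?ltW.
  have -> : r^-1 *: (b *: y) = (r / b)^-1 *: y by rewrite scalerA invfM invrK.
  by apply: rho_ltW; rewrite ltr_pdivlMr// mulrC.
apply/le_anti; rewrite le//=.
have := le a^-1 (a *: x); rewrite invr_gt0 => /(_ a0).
by rewrite scalerA mulVf ?gt_eqF// scale1r ler_pdivlMl.
Qed.

(** The rescaled sum is a convex combination of the rescaled summands. Enlarging both radii by
    [e / 2] keeps them positive. *)
Lemma rho_triangle x y : rho Omega (x + y) <= rho Omega x + rho Omega y.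
Proof.
apply/ler_addgt0Pr => e e0; have e20 : 0 < e / 2 by rewrite divr_gt0.
set a := rho Omega x; set b := rho Omega y.
have a0 : 0 < a + e / 2 by rewrite ltr_wpDl ?rho_ge0.
have b0 : 0 < b + e / 2 by rewrite ltr_wpDl ?rho_ge0.
have -> : a + b + e = (a + e / 2) + (b + e / 2) by rewrite addrACA -splitr.
have ab0 := addr_gt0 a0 b0.
apply/rho_le => //.
have Ox : Omega ((a + e / 2)^-1 *: x) by apply: rho_ltW; rewrite ltrDl.
have Oy : Omega ((b + e / 2)^-1 *: y) by apply: rho_ltW; rewrite ltrDl.
move: (a + e / 2) (b + e / 2) a0 b0 ab0 Ox Oy => {}a {}b a0 b0 ab0 Ox Oy.
have -> : (a + b)^-1 *: (x + y) =
    (a / (a + b)) *: (a^-1 *: x) + (1 - a / (a + b)) *: (b^-1 *: y).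
  have -> : 1 - a / (a + b) = b / (a + b) by field; rewrite gt_eqF.
  rewrite !scalerA scalerDr !(mulrAC _ (a + b)^-1) !mulfV ?gt_eqF// !mul1r.
  by [].
apply: body_convex => //.
by rewrite divr_ge0 ?(ltW a0) ?(ltW ab0)//= ler_pdivrMr// mul1r lerDl ltW.
Qed.

(** A ball of radius [r] inside [Omega] gives [rho v <= |v| / r]; the triangle inequality does the
    rest. *)
Lemma rho_lipschitz : exists2 L, 0 < L &
  forall x y, rho Omega x <= rho Omega y + L * `|x - y|.
Proof.
have [r r0 rO] := body_ball; exists r^-1; first by rewrite invr_gt0.
move=> x y; rewrite -{1}(subrK y x) addrC.
apply: le_trans (rho_triangle _ _) _; rewrite lerD2l.
have [->|xy] := eqVneq (x - y) 0; first by rewrite rho0 normr0 mulr0.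
have nxy : 0 < r^-1 * `|x - y| by rewrite mulr_gt0 ?invr_gt0 ?normr_gt0.
apply/rho_le => //; apply: rO.
rewrite normrZ normfV (gtr0_norm nxy) invfM invrK -mulrA mulVf ?mulr1//.
by rewrite normr_eq0.
Qed.

Lemma rho_map (M : 'M[R]_n) x : (forall y, Omega y -> Omega (M *m y)) ->
  rho Omega (M *m x) <= rho Omega x.
Proof.
move=> OM; apply: rho_leP => [|r xr]; first exact: rho_ge0.
by rewrite scalemxAr; apply/OM/rho_ltW.
Qed.

Lemma rho_sphere_compact : compact [set x | rho Omega x = 1].
Proof.
have [L L0 rhoL] := rho_lipschitz; case: body => cO _ _.
apply: subclosed_compact cO _ => [|x /= x1]; last first.
  by have /rho_le := lexx (rho Omega x); rewrite x1 invr1 scale1r; apply.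
move=> x xS; apply/eqP; rewrite -subr_eq0 -normr_le0.
apply/ler_addgt0Pr => e e0; rewrite add0r.
have eL : 0 < e / L by rewrite divr_gt0.
have [y [/= y1]] := xS _ (nbhsx_ballx x _ eL).
rewrite -ball_normE/= ltr_pdivlMr// mulrC => xy.
have := rhoL x y; have := rhoL y x; rewrite (distrC y) y1 ler_norml.
by move: xy; clear; move=> ? ? ?; apply/andP; split; lra.
Qed.

End Gauge.

(** * The gradient of the norm *)

Section Gradient.
Context {R : realType} {n : nat}.
Implicit Types (x y v q : 'cV[R]_n).

Lemma derive_ge0_right_min (k : R -> R) (t l : R) :
  is_derive t 1 k l -> (forall s, t <= s -> k t <= k s) -> 0 <= l.
Proof.
move=> dk kmin; apply/ler_addgt0Pr => e e0.
have [r r0 kr] := derive_straddle e0 dk.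
have r20 : 0 < r / 2 by rewrite divr_gt0.
have H : k (t + r / 2) - k t <= (l + e) * (r / 2).
  rewrite [X in (l + e) * X](_ : _ = t + r / 2 - t); last first.
    by rewrite addrAC subrr add0r.
  apply: kr.
  - by rewrite lexx lerDl ltW.
  - by rewrite ltrBlDr ltrDl.
  - by rewrite ltrD2l ltr_pdivrMr// ltr_pMr// ltr1n.
have : 0 <= (l + e) * (r / 2).
  by apply: le_trans H; rewrite subr_ge0 kmin// lerDl ltW.
by rewrite pmulr_lge0.
Qed.

Lemma derive_dot_gradient (f : 'cV[R]_n -> R) x v :
  differentiable f x -> 'd f x v = dot (gradient f x) v.
Proof.
move=> df; rewrite [in LHS](matrix_sum_delta v) linear_sum/=.
apply: eq_bigr => i _; rewrite big_ord1 linearZ/= mxE deriveE// mulrC.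
by [].
Qed.

Lemma is_derive_gradient (f : 'cV[R]_n -> R) (y : R -> 'cV[R]_n) (t : R) y' :
  differentiable f (y t) -> is_derive t 1 y y' ->
  is_derive t 1 (fun s => f (y s)) (dot (gradient f (y t)) y').
Proof.
move=> df [dy ey]; have dy' := (derivable1_diffP _ _).1 dy.
have dfy : differentiable (f \o y) t by exact: differentiable_comp.
split; first exact/derivable1_diffP.
rewrite -derive_dot_gradient// -ey !deriveE// -[X in 'd X _]/(f \o y).
by rewrite diff_comp.
Qed.

Lemma is_derive_line v x (a t : R) :
  is_derive t 1 (fun h : R => (h * a) *: v + x) (a *: v).
Proof.
apply/is_derive_mxP => i j.
have -> : (fun h : R => ((h * a) *: v + x) i j) = (fun h => (a * v i j) *: h + x i j).
  by apply/funext => h; rewrite !mxE /GRing.scale/=; ring.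
have := is_deriveD (is_deriveZ (a * v i j) (is_derive_id t (1 : R)))
  (is_derive_cst (x i j) t (1 : R)).
by rewrite addr0 /GRing.scale/= mulr1 mxE.
Qed.

Variable Omega : set 'cV[R]_n.
Hypothesis body : convex_body Omega.
Hypothesis Omega_opp : forall x, Omega x -> Omega (- x).
Hypothesis rho_diff : forall x, x != 0 -> differentiable (rho Omega) x.
Let rhoO := rho Omega.
Let grad := gradient (rho Omega).

(** Euler's identity for degree 1. The ray is parametrized by [expR h], so that the scaling factor
    is positive for every [h]. *)
Lemma gradient_rho_self x : x != 0 -> dot (grad x) x = rhoO x.
Proof.
move=> x0.
have d1 : is_derive (0 : R) 1 (fun h : R => rhoO (expR h *: x)) (dot (grad x) x).
  have dy : is_derive (0 : R) 1 (fun h : R => expR h *: x) x.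
    apply/is_derive_mxP => i j.
    have -> : (fun h => (expR h *: x) i j) = (fun h => x i j * expR h).
      by apply/funext => h; rewrite mxE mulrC.
    have := is_deriveZ (x i j) (is_derive_expR (0 : R)).
    by move/is_derive_eq; apply; rewrite expR0 /GRing.scale/= mulr1.
  have := @is_derive_gradient rhoO _ _ _ _ dy.
  by rewrite /= expR0 scale1r; apply; exact: rho_diff.
have d2 : is_derive (0 : R) 1 (fun h : R => rhoO (expR h *: x)) (rhoO x).
  have -> : (fun h => rhoO (expR h *: x)) = (fun h => rhoO x * expR h).
    by apply/funext => h; rewrite /rhoO rhoZ ?expR_gt0// mulrC.
  have := is_deriveZ (rhoO x) (is_derive_expR (0 : R)).
  by move/is_derive_eq; apply; rewrite expR0 /GRing.scale/= mulr1.
by case: d1 => _ <-; case: d2.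
Qed.

(** Differentiate [rho (a x + s v) = a rho (x + (s / a) v)] at [s = 0]. *)
Lemma gradient_rhoZ a x : 0 < a -> x != 0 -> grad (a *: x) = grad x.
Proof.
move=> a0 x0.
suff eq_dot v : dot (grad (a *: x)) v = dot (grad x) v.
  apply/matrixP => i j; rewrite (ord1 j).
  by have := eq_dot (delta_mx i 0); rewrite !(dotC _ (delta_mx _ _)) !dot_delta.
have ax0 : a *: x != 0 by rewrite scaler_eq0 (gt_eqF a0).
have h1 := is_derive_line v (a *: x) 1 0.
have h2 := is_derive_line v x a^-1 0.
have d1 := @is_derive_gradient rhoO _ _ _ _ h1.
have d2 := @is_derive_gradient rhoO _ _ _ _ h2.
rewrite /= !mul0r !scale0r !add0r scale1r in d1 d2.
have {}d1 := d1 (rho_diff ax0).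
have := is_deriveZ a (d2 (rho_diff x0)).
have -> : a \*: (fun s : R => rhoO ((s / a) *: v + x)) =
    (fun s => rhoO ((s * 1) *: v + a *: x)).
  apply/funext => s; rewrite -[LHS]/(a * rhoO ((s / a) *: v + x)) /rhoO -rhoZ//.
  by rewrite scalerDr scalerA mulrCA mulfV ?gt_eqF.
case: d1 => _ <- [_ ->]; rewrite dotZr /GRing.scale/= mulrA mulfV ?mul1r//.
by rewrite gt_eqF.
Qed.

Lemma gradient_rho_descent (y : R -> 'cV[R]_n) y' :
  y 0 != 0 -> is_derive (0 : R) 1 y y' ->
  (forall s, 0 <= s -> rhoO (y s) <= rhoO (y 0)) -> dot (grad (y 0)) y' <= 0.
Proof.
move=> y0 dy ymax; have d1 := is_derive_gradient (rho_diff y0) dy.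
rewrite -oppr_ge0; apply: derive_ge0_right_min (is_deriveN d1) _ => s s0.
by rewrite lerN2; exact: ymax.
Qed.

(** The difference of [rho] and its composition with [M] is nonnegative and vanishes at [x], so its
    derivative there is nonnegative in every direction; taking [q] and [- q] gives equality. *)
Lemma gradient_rho_pullback (M : 'M[R]_n) x q : x != 0 ->
  (forall y, rhoO (M *m y) <= rhoO y) -> rhoO (M *m x) = rhoO x ->
  dot (grad (M *m x)) (M *m q) = dot (grad x) q.
Proof.
move=> x0 Mle Mx.
have Mx0 : M *m x != 0.
  apply/eqP => Mx0; have := rho_gt0 body Omega_opp x0.
  by rewrite -/rhoO -Mx Mx0 /rhoO rho0 ltxx.
have le v : dot (grad (M *m x)) (M *m v) <= dot (grad x) v.
  have h1 := is_derive_line v x 1 0.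
  have h2 := is_derive_line (M *m v) (M *m x) 1 0.
  have d1 := @is_derive_gradient rhoO _ _ _ _ h1.
  have d2 := @is_derive_gradient rhoO _ _ _ _ h2.
  rewrite /= !mul0r !scale0r !add0r !scale1r in d1 d2.
  have d12 := is_deriveB (d1 (rho_diff x0)) (d2 (rho_diff Mx0)).
  rewrite -subr_ge0; apply: derive_ge0_right_min d12 _ => s s0.
  rewrite -[leLHS]/(rhoO ((0 * 1) *: v + x) - rhoO ((0 * 1) *: (M *m v) + M *m x)).
  rewrite !mul0r !scale0r !add0r Mx subrr subr_ge0.
  by rewrite scalemxAr -mulmxDr; exact: Mle.
apply/le_anti; rewrite le/=.
by have := le (- q); rewrite mulmxN !dotNr lerN2.
Qed.

End Gradient.

(** * Motion under the feedback *)

Section Feedback.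
Context {R : realType} {n : nat}.
Implicit Types (x y v w q : 'cV[R]_n).
Variables (A : 'M[R]_n) (B : 'cV[R]_n) (Phi : R -> 'M[R]_n).
Variable Omega : set 'cV[R]_n.
Hypothesis flow : bounded_flow A Phi.
Hypothesis asym : asymptotic_body A B Omega.
Hypothesis regular : regular_body Omega.

Let body : convex_body Omega. Proof. by case: asym. Qed.
Let Omega_opp v : Omega v -> Omega (- v). Proof. exact: body_opp asym. Qed.
Let rho_diff v : v != 0 -> differentiable (rho Omega) v.
Proof. by case: regular => _ _ H _ _; exact: H. Qed.
Let rhoO := rho Omega.
Let grad := gradient (rho Omega).

Lemma rho_flow_le s v : 0 <= s -> rhoO (Phi s *m v) <= rhoO v.
Proof.
by move=> s0; apply: rho_map => // w; exact: body_flow flow asym s0.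
Qed.

Lemma gradient_rho_drift v : v != 0 -> dot (grad v) (A *m v) <= 0.
Proof.
move=> v0; have [flow0 _ dPhi _] := flow.
have dy : is_derive (0 : R) 1 (fun s => Phi s *m v) (A *m v).
  have := is_derive_mulmx (dPhi 0) (is_derive_cst v (0 : R) (1 : R)).
  by rewrite mulmx0 addr0 flow0 mulmx1.
have := gradient_rho_descent rho_diff _ dy.
by rewrite flow0 mul1mx; apply => // s; exact: rho_flow_le.
Qed.

(** By the chain rule the derivative is a drift term, which is at most 0, plus [u t] times the
    pairing of [B] with the gradient. The feedback turns the latter into minus its absolute value,
    and both are 0 where the pairing vanishes. *)
Lemma feedback_rate T u (x : R -> 'cV[R]_n) : feedback_motion A B Omega T u x ->
  {ae lebesgue_measure, forall t : R, 0 <= t <= T -> x t != 0 ->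
    exists2 l, l <= - `|dot B (grad (x t))| &
      is_derive t 1 (fun s => rhoO (x s)) l}.
Proof.
move=> [[_ _ dx] ux]; apply: ae_imply2 dx ux => t dx ux tT xt0.
have {}tT : t \in `[0, T] by rewrite in_itv.
exists (dot (grad (x t)) (A *m x t + u t *: B)); last first.
  exact: is_derive_gradient (rho_diff xt0) (dx tT).
rewrite dotDr dotZr -[leRHS]add0r lerD//; first exact: gradient_rho_drift.
have [_ ut] := ux tT; rewrite (dotC _ B).
have [->|nz] := eqVneq (dot B (grad (x t))) 0.
  by rewrite mulr0 normr0 oppr0.
by rewrite ut// mulNr normrEsg.
Qed.

(** Integrates the rate: [rho] is Lipschitz, hence absolutely continuous along [x]. The case [d = 0]
    gives monotonicity away from the origin. *)
Lemma feedback_drop T u (x : R -> 'cV[R]_n) (a b d : R) :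
  feedback_motion A B Omega T u x -> 0 <= a -> a <= b -> b <= T ->
  (forall t, a <= t <= b -> x t != 0 /\ d <= `|dot B (grad (x t))|) ->
  rhoO (x b) <= rhoO (x a) - d * (b - a).
Proof.
move=> fb a0 ab bT xd; have [sol _] := fb.
have [acx _] := solution_restrict sol a0 bT.
have [L L0 rhoL] := rho_lipschitz body Omega_opp.
suff : rhoO (x b) - rhoO (x a) <= - d * (b - a).
  by rewrite mulNr lerBlDl.
apply: (@abs_cont_slope_le _ (fun t => rhoO (x t))) => //.
  apply: (@abs_cont_dominated _ _ _ _ _ x _ L acx) => s t _ _.
  have := rhoL (x s) (x t); have := rhoL (x t) (x s).
  rewrite (distrC (x s)) mulrDr ler_norml -/rhoO.
  have : 0 <= L * `|t - s| by rewrite mulr_ge0// ltW.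
  by move=> ? ? ?; apply/andP; split; lra.
apply: ae_imply (feedback_rate fb) => t + tab.
have /andP[at_ tb] := tab; have [xt0 dt] := xd t tab.
rewrite (le_trans a0 at_) (le_trans tb bT) => /(_ isT xt0)[l ld dl].
by exists l => //; apply: le_trans ld _; rewrite lerN2.
Qed.

(* Where [x] vanishes the feedback is arbitrary, but there [rho] is small. *)
Lemma feedback_nonincreasing T u (x : R -> 'cV[R]_n) a b :
  feedback_motion A B Omega T u x -> 0 <= a -> a <= b -> b <= T ->
  rhoO (x b) <= rhoO (x a).
Proof.
move=> fb a0 ab bT; apply/ler_addgt0Pr => e e0.
have [sol _] := fb; have [acx _] := solution_restrict sol a0 bT.
have [L L0 rhoL] := rho_lipschitz body Omega_opp.
have near_x z r : a <= z <= b -> 0 < r -> exists2 d, 0 < d & forall t,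
    a <= t <= b -> `|t - z| < d -> `|x t - x z| < r.
  move=> /andP[az zb] r0; have [d d0 xd] := abs_cont_unif acx r0.
  exists d => // t /andP[at_ tb]; have [zt|tz] := leP z t.
    by rewrite ger0_norm ?subr_ge0//; exact: xd.
  by rewrite ltr0_norm ?subr_lt0// opprB distrC; apply: xd => //; exact: ltW.
apply: (@interval_induction _ a b (fun t => rhoO (x t) <= rhoO (x a) + e)) => //.
  by rewrite lerDl ltW.
move=> z zab; have [xz0|xz0] := eqVneq (x z) 0.
  have [d d0 xd] := near_x z (e / L) zab (divr_gt0 e0 L0).
  exists d => // s t as_ tb /andP[sz zt] zs tz _.
  have : `|x t - x z| < e / L.
    apply: xd; first by rewrite tb (le_trans as_ (le_trans sz zt)).
    by rewrite ger0_norm ?subr_ge0// ltrBlDl.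
  rewrite ltr_pdivlMr// mulrC => xtz.
  apply: le_trans (rhoL _ (x z)) _; rewrite xz0 rho0 add0r -{1}xz0.
  by apply: ltW; apply: lt_le_trans xtz _; rewrite lerDr; exact: rho_ge0.
have nx : 0 < `|x z| by rewrite normr_gt0.
have [d d0 xd] := near_x z _ zab nx.
exists d => // s t as_ tb /andP[sz zt] zs tz; apply: le_trans.
have := @feedback_drop T u x s t 0 fb
  (le_trans a0 as_) (le_trans sz zt) (le_trans tb bT).
rewrite mul0r subr0; apply => r /andP[sr rt]; split => //.
apply/eqP => xr0; have := xd r; rewrite xr0 sub0r normrN ltxx.
rewrite (le_trans as_ sr) (le_trans rt tb) => H.
suff : `|r - z| < d by move/(H isT).
by rewrite ltr_distl (lt_le_trans zs sr) (le_lt_trans rt tz).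
Qed.

Hypothesis ctrl : controllable A B.

Let Phi_norm : exists2 k, 0 < k & forall s v, `|Phi s *m v| <= k * `|v|.
Proof.
have [_ _ _ [K K0 PhiK]] := flow.
exists (n%:R * K + 1); first by rewrite ltr_wpDl// mulr_ge0// ltW.
move=> s v; apply: le_trans (mulmx_norm_le _ _) _; rewrite ler_wpM2r//.
by rewrite ler_wpDr// ler_wpM2l.
Qed.

(* Applied to a rescaled motion [w] that stays [d]-close to the free motion
   from [v]; there [|<B, grad w>|] is the decay rate of [rho]. *)
Definition robust_decay d v : Prop :=
  (forall w, `|w - Phi 1 *m v| <= d -> rhoO w <= 1 - d) \/
  (exists2 s0, 0 <= s0 <= 1 & forall s w, `|s - s0| <= d ->
    `|w - Phi s *m v| <= d -> d <= `|dot B (grad w)|).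

(** Whether the free motion from [v0] keeps [rho] equal to 1 up to time 1 decides which alternative
    holds; continuity extends it to all [v] near [v0], with every small [d]. *)
Lemma robust_decay_near v0 : rhoO v0 = 1 ->
  exists2 e, 0 < e & forall d v, 0 < d -> d <= e -> `|v - v0| <= e ->
    robust_decay d v.
Proof.
move=> v1.
have v0_neq0 : v0 != 0.
  by apply/eqP => z; move/eqP: v1; rewrite z /rhoO rho0 eq_sym oner_eq0.
have [k k0 Phik] := Phi_norm.
have [L L0 rhoL] := rho_lipschitz body Omega_opp.
have := rho_flow_le v0 ler01; rewrite v1 le_eqVlt => /predU1P[stay|drop].
  have stay_s s : 0 <= s <= 1 -> rhoO (Phi s *m v0) = 1.
    move=> /andP[s0 s1]; apply/le_anti; rewrite -{1}v1 rho_flow_le//=.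
    rewrite -stay -(subrK s 1) (flowD flow) -mulmxA.
    by apply: rho_flow_le; rewrite subr_ge0.
  (* Otherwise the pullback identity makes [grad v0] orthogonal to [Phi (- s) *m B] for [0 < s < 1].
     Observability then gives [grad v0 = 0], against Euler's identity. *)
  have [s0 s01 Bs0] : exists2 s, 0 <= s <= 1 & dot B (grad (Phi s *m v0)) != 0.
    apply: contrapT => none.
    suff g0 : grad v0 = 0.
      have := gradient_rho_self body Omega_opp rho_diff v0_neq0.
      rewrite -/rhoO -/grad g0 v1 -(scale0r (0 : 'cV[R]_n)) dotC dotZr mul0r.
      by move/eqP; rewrite eq_sym oner_eq0.
    apply: (observable flow ctrl) => s /andP[s0 s1].
    have s01 : 0 <= s <= 1 by rewrite (ltW s0) (ltW s1).
    have := @gradient_rho_pullback _ _ _ body Omega_opp rho_diff (Phi s) v0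
      (Phi (- s) *m B) v0_neq0.
    rewrite mulmxA (flowKN flow) mul1mx => <-.
    + apply: contrapT => /eqP nz; apply: none; exists s => //.
      by rewrite dotC.
    + by move=> y; apply: rho_flow_le; exact: ltW.
    + by rewrite -/rhoO stay_s.
  set w0 := Phi s0 *m v0 in Bs0.
  have w0_neq0 : w0 != 0.
    apply/eqP => z; have := stay_s _ s01; rewrite -/w0 z /rhoO rho0 => /eqP.
    by rewrite eq_sym oner_eq0.
  pose eta := `|dot B (grad w0)| / 2.
  have eta0 : 0 < eta by rewrite divr_gt0// normr_gt0.
  have [r r0 gradr] : exists2 r, 0 < r & forall w, `|w - w0| < r ->
      eta <= `|dot B (grad w)|.
    have cg : {for w0, continuous grad}.
      apply: differentiable_continuous.
      by case: regular => _ _ _ H _; exact: H.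
    have Bn : 0 < n%:R * `|B| + 1 by rewrite ltr_wpDl// mulr_ge0.
    have FF : Filter (nbhs w0) := nbhs_filter w0.
    have [r /= r0 gr] := (nbhs_ballP _ _).1
      ((@cvgrPdist_lt _ _ _ (nbhs w0) FF _ _).1 cg _ (divr_gt0 eta0 Bn)).
    exists r => // w ww0; have /gr : ball w0 r w by rewrite -ball_normE/= distrC.
    rewrite /= ltr_pdivlMr// => gw.
    have E : dot B (grad w0) = dot B (grad w0 - grad w) + dot B (grad w).
      by rewrite -dotDr subrK.
    have := ler_normD (dot B (grad w0 - grad w)) (dot B (grad w)).
    rewrite -E; have := dot_norm_le B (grad w0 - grad w).
    have etaE : `|dot B (grad w0)| = 2 * eta by rewrite /eta mulrC divfK.
    rewrite etaE; move: gw; rewrite mulrDr mulr1 [_ * (n%:R * _)]mulrC.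
    have := normr_ge0 (grad w0 - grad w).
    move: (_ * `|grad w0 - grad w|) => z; lra.
  have [_ _ _ [K K0 PhiK]] := flow.
  have [L' L'0 PhiL] := flow_lipschitz flow.
  (* The three summands account for the errors in [w], in [v] and in [s]. *)
  pose D := 1 + k + n%:R * L' * `|v0|.
  have D0 : 0 < D.
    by rewrite /D !ltr_wpDr ?mulr_ge0 ?(ltW k0) ?(ltW L'0).
  pose e := Num.min eta (r / 2 / D).
  have e0 : 0 < e by rewrite lt_min eta0 !divr_gt0.
  exists e => // d v d0 de ve; right; exists s0 => // s w sd wd.
  apply: le_trans (gradr w _); first by move: de; rewrite le_min => /andP[].
  have -> : w - w0 = (w - Phi s *m v) + Phi s *m (v - v0) + (Phi s - Phi s0) *m v0.
    by rewrite mulmxBr mulmxBl !addrA !subrK.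
  apply: (@le_lt_trans _ _ (e * D)).
    rewrite /D !mulrDr mulr1.
    apply: le_trans (ler_normD _ _) _; apply: lerD.
      apply: le_trans (ler_normD _ _) _; apply: lerD; first exact: le_trans wd de.
      by apply: le_trans (Phik _ _) _; rewrite mulrC ler_wpM2r// ltW.
    apply: le_trans (mulmx_norm_le _ _) _.
    rewrite mulrA ler_wpM2r// mulrCA ler_wpM2l//.
    apply: le_trans (PhiL _ _) _; rewrite mulrC ler_wpM2r ?(ltW L'0)//.
    exact: le_trans sd de.
  apply: (@le_lt_trans _ _ (r / 2)).
    by rewrite -ler_pdivlMr// ge_min lexx orbT.
  by rewrite ltr_pdivrMr// ltr_pMr// ltr1n.
pose gamma := 1 - rhoO (Phi 1 *m v0).
have gamma0 : 0 < gamma by rewrite subr_gt0.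
(* With [e = gamma / D], the errors in [w] and [v] cost at most [L * e + L * k * e = gamma - e], so
   a drop of at least [e] remains. *)
pose D := 1 + L + L * k.
have D0 : 0 < D by rewrite /D !ltr_wpDr ?mulr_ge0 ?(ltW k0) ?(ltW L0).
exists (gamma / D) => [|d v d0 de ve]; first by rewrite divr_gt0.
left=> w wd.
have h : `|w - Phi 1 *m v0| <= d + k * (gamma / D).
  have -> : w - Phi 1 *m v0 = (w - Phi 1 *m v) + Phi 1 *m (v - v0).
    by rewrite mulmxBr addrA subrK.
  apply: le_trans (ler_normD _ _) _; apply: lerD => //.
  by apply: le_trans (Phik _ _) _; rewrite ler_wpM2l// ltW.
apply: le_trans (rhoL w (Phi 1 *m v0)) _.
have {}h : L * `|w - Phi 1 *m v0| <= L * (gamma / D + k * (gamma / D)).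
  rewrite ler_wpM2l ?(ltW L0)//; apply: le_trans h _.
  by rewrite lerD2r.
have gD : gamma / D * (1 + L + L * k) = gamma by rewrite -/D divfK// gt_eqF.
move: h de gD; rewrite -/rhoO /gamma; move: (_ / D) => z; nra.
Qed.

(** Compactness of the unit sphere in its near-covering form: each local statement holds for all
    small [d], so one [d] serves everywhere. *)
Lemma robust_decay_uniform : exists2 d, 0 < d &
  forall v, rhoO v = 1 -> robust_decay d v.
Proof.
have /compact_near_coveringP cover := rho_sphere_compact body Omega_opp.
have near_decay : \forall d \near (0 : R)^'+,
    [set v | rhoO v = 1] `<=` robust_decay d.
  apply: cover => v0 /robust_decay_near[e e0 near_v0].
  exists (ball v0 e, [set d | 0 < d <= e]) => /=.
    split; first exact: nbhsx_ballx.
    near=> d; apply/andP; split; near: d; first exact: nbhs_right_gt.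
    exact: nbhs_right_le.
  move=> [v d] /= [ve /andP[d0 de]]; apply: near_v0 => //.
  by move: ve; rewrite -ball_normE/= distrC => /ltW.
have [d [d0 decay]] := filter_ex (filterI (nbhs_right_gt (0 : R)) near_decay).
by exists d.
Unshelve. all: by end_near. Qed.

(** Dividing by [rho (x k)] puts the initial state on the unit sphere. Then either the whole unit
    step shrinks [rho] by a factor, or [rho] falls at rate [d] on a window of length [h] and does
    not grow on the rest. *)
Lemma feedback_unit_drop : exists C d, [/\ 0 < C, 0 < d &
  forall T u (x : R -> 'cV[R]_n) k, feedback_motion A B Omega T u x ->
    0 <= k -> k + 1 <= T -> (forall t, k <= t <= k + 1 -> C <= rhoO (x t)) ->
    rhoO (x (k + 1)) <= rhoO (x k) - d].
Proof.
have [d d0 decay] := robust_decay_uniform.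
have [c c0 drift] := drift_bound flow B.
(* A window of length [h] with end [s0] fits into [[0, 1]] on one side and stays within [d] of
   [s0]. *)
pose h := Num.min d 2^-1.
have h0 : 0 < h by rewrite lt_min d0 invr_gt0 ltr0n.
have h12 : h <= 2^-1 by rewrite ge_min lexx orbT.
have hd : h <= d by rewrite ge_min lexx.
(* For [rho (x k)] above this level, the rescaled control error [c / rho (x k)] is at most [d], and
   a relative loss [d] is an absolute loss of at least [d]. *)
exists (1 + c / d), (d * h); split; [|exact: mulr_gt0|].
  by rewrite ltr_wpDr// divr_ge0// ltW.
move=> T u x k fb k0 k1T large.
have [sol u1] := fb.
have {}u1 : {ae lebesgue_measure, forall t : R, 0 <= t <= T -> `|u t| <= 1}.
  by apply: ae_imply u1 => t ut tT; case: ut; rewrite ?in_itv.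
have xt_neq0 t : k <= t <= k + 1 -> x t != 0.
  move/large => Ct; apply/eqP => xt0; move: Ct; rewrite xt0 /rhoO rho0 leNgt.
  by rewrite ltr_wpDr// divr_ge0// ltW.
have k_in : k <= k <= k + 1 by rewrite lexx lerDl ler01.
pose l := rhoO (x k).
have l1c : 1 + c / d <= l := large _ k_in.
have l1 : 1 <= l by apply: le_trans l1c; rewrite lerDl divr_ge0// ltW.
have l0 : 0 < l by exact: lt_le_trans l1.
pose v := l^-1 *: x k.
have v1 : rhoO v = 1.
  by rewrite /rhoO rhoZ ?invr_gt0// -/rhoO -/l mulVf// gt_eqF.
have follow s : 0 <= s <= 1 -> `|l^-1 *: x (k + s) - Phi s *m v| <= d.
  move=> /andP[s0 s1]; rewrite -scalemxAr -scalerBr normrZ normfV (gtr0_norm l0).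
  rewrite ler_pdivrMl//.
  have := drift T u x k (k + s) sol u1 k0; rewrite lerDl addrAC subrr add0r.
  move=> /(_ s0); rewrite (le_trans _ k1T) ?lerD2l// => /(_ isT) xs.
  apply: le_trans xs _; apply: (@le_trans _ _ c); first by rewrite ler_piMr// ltW.
  rewrite -ler_pdivrMr//; apply: le_trans l1c; by rewrite lerDr.
have [drop|[s0 s01 rate]] := decay v v1.
  have := drop _ (follow 1 _); rewrite lexx ler01 => /(_ isT).
  rewrite /rhoO rhoZ ?invr_gt0// -/rhoO ler_pdivrMl// => drop1.
  apply: le_trans drop1 _; rewrite mulrBr mulr1 lerD2l lerN2.
  apply: (@le_trans _ _ (d * 1)); last by rewrite mulr1 ler_peMl// ltW.
  by rewrite ler_wpM2l ?(ltW d0)//; lra.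
have [a [a0 ah1 ad]] : exists a, [/\ 0 <= a, a + h <= 1 &
    forall s, a <= s <= a + h -> `|s - s0| <= d].
  have [s0h|s0h] := leP s0 2^-1.
    exists s0; split; [by case/andP: s01|lra|] => s /andP[? ?].
    by rewrite ger0_norm ?subr_ge0//; lra.
  exists (s0 - h); split; [lra|by case/andP: s01; lra|] => s /andP[? ?].
  by rewrite ler0_norm ?subr_le0//; lra.
have rate_x t : k + a <= t <= k + (a + h) ->
    x t != 0 /\ d <= `|dot B (grad (x t))|.
  move=> /andP[at_ th].
  have s_in : a <= t - k <= a + h by rewrite lerBrDl at_ lerBlDl.
  have s_in1 : 0 <= t - k <= 1.
    by case/andP: s_in => ? ?; apply/andP; split; lra.
  have tE : k + (t - k) = t by rewrite addrC subrK.
  have xt0 : x t != 0.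
    by apply: xt_neq0; case/andP: s_in1 => ? ?; apply/andP; split; lra.
  (* The rate is known at the rescaled state; homogeneity of degree 0 moves it to [x t]. *)
  split => //; have := rate _ _ (ad _ s_in) (follow _ s_in1).
  by rewrite tE /grad gradient_rhoZ ?invr_gt0.
have a_k1 : k + (a + h) <= k + 1 by rewrite lerD2l.
have a_ah : k + a <= k + (a + h) by rewrite lerD2l lerDl ltW.
have ka0 : 0 <= k + a by rewrite addr_ge0.
have := feedback_nonincreasing fb k0 (_ : k <= k + a) _.
rewrite lerDl => /(_ a0 (le_trans a_ah (le_trans a_k1 k1T))) drop_fst.
have := feedback_nonincreasing fb (le_trans ka0 a_ah) a_k1 k1T => drop_lst.
have := feedback_drop fb ka0 a_ah (le_trans a_k1 k1T) rate_x.
have -> : k + (a + h) - (k + a) = h by ring.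
move=> drop_mid; apply: le_trans drop_lst _; apply: le_trans drop_mid _.
by rewrite lerD2r.
Qed.

End Feedback.

(** * From the unit-time drop to the bound on the transfer time *)

Theorem theorem2 (R : realType) (N : nat) (A : 'M[R]_N) (B : 'cV[R]_N)
  (A_diag : diagonalizable_over_C A)
  (A_spec : purely_imaginary_spectrum A)
  (AB_ctrl : controllable A B) :
  exists C c : R, [/\ 0 < C, 0 < c &
    forall Omega : set 'cV[R]_N,
      asymptotic_body A B Omega -> regular_body Omega ->
      forall (T : nat) (M N1 : R), C <= M -> C <= N1 ->
        moves_between_levels A B Omega T%:R M N1 ->
        T%:R <= c * (M - N1)].
Proof.
have [Phi flow] := bounded_flow_exists A_diag A_spec.
(* The constants must precede [Omega]. They are taken from one regular asymptotic body, which equals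
   every other by uniqueness; if there is none, the claim is vacuous. *)
have [[body [asym reg]]|none] := pselect (exists Omega : set 'cV[R]_N,
    asymptotic_body A B Omega /\ regular_body Omega); last first.
  exists 1, 1; split=> // Omega asym reg.
  by exfalso; apply: none; exists Omega.
have [C [d [C0 d0 drop]]] := feedback_unit_drop flow asym reg AB_ctrl.
exists C, d^-1; split=> //; first by rewrite invr_gt0.
move=> Omega /(asymptotic_body_unique asym) <- _ T M N1 _ CN1.
move=> [u [x [fb xM xN1]]].
(* As [rho] does not increase, it stays at or above its final value [N1], hence above [C], so every
   unit step drops by [d]. *)
have large t : 0 <= t <= T%:R -> C <= rho body (x t).
  move=> /andP[t0 tT]; apply: le_trans CN1 _; rewrite -xN1.
  exact: (feedback_nonincreasing flow asym reg fb).
have iter m : (m <= T)%N -> rho body (x m%:R) <= M - d * m%:R.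
  elim: m => [_|m IH mT]; first by rewrite mulr0 subr0 xM.
  have mT' : m%:R + 1 <= T%:R :> R by rewrite natr1 ler_nat.
  rewrite -natr1; apply: le_trans (drop _ _ _ _ fb (ler0n _ m) mT' _) _.
    move=> t /andP[mt tm]; apply: large.
    by rewrite (le_trans (ler0n R m) mt) (le_trans tm mT').
  by have := IH (ltnW mT); lra.
have := iter T (leqnn T); rewrite xN1 => H.
by rewrite ler_pdivlMl//; move: H; lra.
Qed.
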